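(* Let $f:\mathbb{C}\to\mathbb{C}$ be a nonconstant entire function and let $a\in\mathbb{C}$ with $a\neq 0$. If $f$ and its derivative $f'$ share their simple $a$-points and share their simple zeroes, then $f\equiv f'$.
   Context: For $c\in\mathbb{C}$, two meromorphic functions $f$ and $g$ on $\mathbb{C}$ are said to share their simple $c$-points if the points where $f$ takes the value $c$ with multiplicity one are exactly the points where $g$ takes the value $c$ with multiplicity one (nothing is required at points where the value $c$ is taken with higher multiplicity). Simple zeroes are simple $0$-points. For $g=f'$ with $f$ entire, sharing simple $c$-points means: for every $z\in\mathbb{C}$, ($f(z)=c$ and $f'(z)\neq 0$) if and only if ($f'(z)=c$ and $f''(z)\neq 0$). *)

(* Defs.v *)
From Stdlib Require Import Reals.
From Coquelicot Require Import Coquelicot.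

Open Scope C_scope.

Definition entire (f : C -> C) : Prop :=
  forall z : C, @ex_derive C_AbsRing C_NormedModule f z.

(* [C_derive] is total (a limit of difference quotients taken along the real
   direction).  By [C_derive_correct] it is the complex derivative wherever the
   function is complex differentiable, hence everywhere if [f] is entire; the
   definitions below are meant for entire functions only. *)
Definition is_simple_point (f : C -> C) (c z : C) : Prop :=
  f z = c /\ C_derive f z <> 0.

Definition share_simple_points (f g : C -> C) (c : C) : Prop :=
  forall z : C, is_simple_point f c z <-> is_simple_point g c z.

(* Main.v *)
(** Sharing the simple points forces every zero of f to have order at least 3, and every a-point of f
    to be either a simple one with f' = a or one of order at least 3. Normalise a = 1 and suppose that
    f' <> f. Consider
      L = |f'|^17 |f' - f|^12 |f|^-19 |f - 1|^-11 P(|f|) P(|f - 1|),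
      P(x) = x^(1/100) + x^(-1/100).
    The exponents are such that L extends continuously by 0 to the points where one of the four functions
    vanishes. Elsewhere the Laplacian of log L comes from the factors P only, and equals
      (1/2500) (w1^2 + w2^2), with w1 = |f'| / (|f| P(|f|)) and w2 = |f'| / (|f - 1| P(|f - 1|)).
    Since |f' - f| <= |f'| + |f|, an elementary estimate (where 19 + 11 > 17 + 12 matters near infinity)
    gives L <= C (w^17 + w^29) for w = max(w1, w2), so that log L is a negatively curved potential. As in
    Ahlfors' lemma, one looks at the maximum of L(z) (R^2 - |z - z0|^2)^29 over the disc of radius R
    about z0: the Laplacian of its logarithm is nonpositive there, which bounds w, hence L, and yields
    L(z0) <= C' R^-17. Letting R tend to infinity gives L(z0) = 0 at every z0, a contradiction. *)
Require Import Defs.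
From Stdlib Require Import Reals Lra Lia Classical ClassicalEpsilon.
From Coquelicot Require Import Coquelicot.
Open Scope R_scope.

(** The exponents are dictated by the places where L could blow up. At a zero of f of order m both
    f' and f' - f vanish to order m - 1, so L vanishes like the power 29 (m - 1) - 19 m = 10 m - 29;
    at a 1-point of order m with f' = 0 the power is 17 (m - 1) - 11 m = 6 m - 17. Both are positive
    exactly from m = 3 on, which is the order that the hypotheses provide. At a simple 1-point with
    f' = 1 only f' - f helps, and the power is at least 12 - 11. Each of these minimal gaps is 1, as
    is 30 - 29 near infinity, which leaves room for P with its small exponent 1/100. P itself is
    indispensable: without it log L is harmonic off the exceptional points and offers no curvature,
    whereas log P(|f|) is a strictly convex function of the harmonic function log |f|. The weight
    has exponent 29 because that is the worst power of w to be cancelled. No Laplace operator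
    appears. At the maximum the second derivative test is applied along the lines in the directions
    1 and i, and the two results are added; every harmonic contribution then drops out. *)

(** * Continuity of complex-valued maps, measured by the modulus *)

Definition ccont {U : UniformSpace} (f : U -> C) (u : U) : Prop :=
  @continuous U C_UniformSpace f u.

(** The uniform structure on C is that of a product, so its balls are squares. The square of
    half-side e lies in the disc of radius [sqrt 2 * e], whence the rescaling by [sqrt 2]. *)
Lemma ccont_eps {U : UniformSpace} (f : U -> C) (u : U) :
  ccont f u <-> forall eps, 0 < eps -> locally u (fun w => Cmod (f w - f u) < eps).
Proof.
  split.
  - intros H eps He.
    assert (H2 : 0 < sqrt 2) by (apply sqrt_lt_R0; lra).
    assert (He' : 0 < eps / sqrt 2) by (apply Rdiv_lt_0_compat; lra).
    generalize (proj1 (filterlim_locally f (f u)) H (mkposreal _ He')).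
    apply filter_imp; intros w Hw.
    apply C_NormedModule_mixin_compat2 in Hw; simpl in Hw.
    replace eps with (sqrt 2 * (eps / sqrt 2)) by (field; lra). exact Hw.
  - intros H. apply filterlim_locally. intros eps.
    generalize (H eps (cond_pos eps)). apply filter_imp; intros w Hw.
    apply C_NormedModule_mixin_compat1. exact Hw.
Qed.

Lemma locally_Cmod (z : C) (P : C -> Prop) :
  @locally C_UniformSpace z P <->
  exists d, 0 < d /\ forall w, Cmod (w - z) < d -> P w.
Proof.
  split.
  - intros [d H]. exists d. split; [apply cond_pos|].
    intros w Hw. apply H. apply C_NormedModule_mixin_compat1. exact Hw.
  - intros [d [Hd H]].
    assert (H2 : 0 < sqrt 2) by (apply sqrt_lt_R0; lra).
    assert (Hd' : 0 < d / sqrt 2) by (apply Rdiv_lt_0_compat; lra).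
    exists (mkposreal _ Hd'). intros w Hw. apply H.
    apply C_NormedModule_mixin_compat2 in Hw; simpl in Hw.
    replace d with (sqrt 2 * (d / sqrt 2)) by (field; lra). exact Hw.
Qed.

Lemma ccont_const {U : UniformSpace} (c : C) (u : U) : ccont (fun _ => c) u.
Proof. apply continuous_const. Qed.

Lemma ccont_id (z : C) : @ccont C_UniformSpace (fun w => w) z.
Proof. apply continuous_id. Qed.

Lemma ccont_plus {U : UniformSpace} (f g : U -> C) (u : U) :
  ccont f u -> ccont g u -> ccont (fun w => (f w + g w)%C) u.
Proof.
  intros Hf Hg. exact (@continuous_plus U R_AbsRing C_R_NormedModule f g u Hf Hg).
Qed.

Lemma ccont_mult {U : UniformSpace} (f g : U -> C) (u : U) :
  ccont f u -> ccont g u -> ccont (fun w => (f w * g w)%C) u.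
Proof.
  intros Hf Hg. apply ccont_eps. intros eps He.
  set (a := Cmod (f u)). set (b := Cmod (g u)).
  assert (Ha : 0 <= a) by apply Cmod_ge_0. assert (Hb : 0 <= b) by apply Cmod_ge_0.
  set (e := Rmin 1 (eps / (a + b + 1))).
  assert (He1 : 0 < eps / (a + b + 1)) by (apply Rdiv_lt_0_compat; lra).
  assert (Hep : 0 < e) by (apply Rmin_pos; lra).
  generalize (filter_and _ _ (proj1 (ccont_eps f u) Hf e Hep)
    (proj1 (ccont_eps g u) Hg e Hep)).
  apply filter_imp. intros w [H1 H2].
  replace (f w * g w - f u * g u)%C
    with ((f w - f u) * (g w - g u) + (f u * (g w - g u) + g u * (f w - f u)))%C by ring.
  assert (Hle : e <= 1) by apply Rmin_l. assert (Hle2 : e <= eps / (a+b+1)) by apply Rmin_r.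
  assert (Hfin : e * (a + b + 1) <= eps).
  { replace eps with (eps / (a+b+1) * (a+b+1)) by (field; lra).
    apply Rmult_le_compat_r; lra. }
  eapply Rle_lt_trans; [apply Cmod_triangle|].
  eapply Rle_lt_trans; [apply Rplus_le_compat_l, Cmod_triangle|].
  rewrite !Cmod_mult. fold a b.
  assert (0 <= Cmod (f w - f u)) by apply Cmod_ge_0.
  assert (0 <= Cmod (g w - g u)) by apply Cmod_ge_0.
  assert (Cmod (f w - f u) * Cmod (g w - g u) < e * 1) by (apply Rmult_le_0_lt_compat; lra).
  assert (a * Cmod (g w - g u) <= a * e) by (apply Rmult_le_compat_l; lra).
  assert (b * Cmod (f w - f u) <= b * e) by (apply Rmult_le_compat_l; lra).
  nra.
Qed.

Lemma ccont_opp {U : UniformSpace} (f : U -> C) (u : U) :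
  ccont f u -> ccont (fun w => (- f w)%C) u.
Proof.
  intros Hf. exact (@continuous_opp U R_AbsRing C_R_NormedModule f u Hf).
Qed.

Lemma ccont_minus {U : UniformSpace} (f g : U -> C) (u : U) :
  ccont f u -> ccont g u -> ccont (fun w => (f w - g w)%C) u.
Proof. intros Hf Hg. apply ccont_plus; [exact Hf | apply ccont_opp, Hg]. Qed.

Lemma continuous_Cmod {U : UniformSpace} (f : U -> C) (u : U) :
  ccont f u -> continuous (fun w => Cmod (f w)) u.
Proof.
  intros H. apply filterlim_locally. intros eps.
  generalize (proj1 (ccont_eps f u) H eps (cond_pos eps)). apply filter_imp.
  intros w Hw. change (Rabs (Cmod (f w) - Cmod (f u)) < eps).
  eapply Rle_lt_trans; [|exact Hw].
  assert (H1 := Cmod_triangle (f w - f u) (f u)).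
  assert (H2 := Cmod_triangle (f u - f w) (f w)).
  replace (f w - f u + f u)%C with (f w) in H1 by ring.
  replace (f u - f w + f w)%C with (f u) in H2 by ring.
  replace (f u - f w)%C with (- (f w - f u))%C in H2 by ring.
  rewrite Cmod_opp in H2. apply Rabs_le; lra.
Qed.

Lemma ccont_ne0 {U : UniformSpace} (f : U -> C) (u : U) :
  ccont f u -> f u <> 0%C ->
  locally u (fun w => Cmod (f u) / 2 < Cmod (f w)).
Proof.
  intros H Hn.
  assert (Hp : 0 < Cmod (f u)) by (apply Cmod_gt_0; exact Hn).
  generalize (proj1 (filterlim_locally _ _) (continuous_Cmod f u H) (mkposreal (Cmod (f u)/2) ltac:(lra))).
  apply filter_imp. intros w Hw.
  change (Rabs (Cmod (f w) - Cmod (f u)) < Cmod (f u)/2) in Hw.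
  apply Rabs_def2 in Hw. lra.
Qed.

Lemma Cmod_pos_ne0 (z : C) : 0 < Cmod z -> z <> 0%C.
Proof. apply Cmod_gt_0. Qed.

Lemma ccont_inv {U : UniformSpace} (f : U -> C) (u : U) :
  ccont f u -> f u <> 0%C -> ccont (fun w => (/ f w)%C) u.
Proof.
  intros H Hn. apply ccont_eps. intros eps He.
  set (m := Cmod (f u)).
  assert (Hp : 0 < m) by (apply Cmod_gt_0; exact Hn).
  assert (Hq : 0 < eps * (m * m / 2)).
  { apply Rmult_lt_0_compat; [lra|]. apply Rdiv_lt_0_compat; [nra|lra]. }
  generalize (filter_and _ _ (ccont_ne0 f u H Hn) (proj1 (ccont_eps f u) H _ Hq)).
  apply filter_imp. intros w [H1 H2]. fold m in H1.
  assert (Hw : f w <> 0%C) by (apply Cmod_pos_ne0; lra).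
  replace (/ f w - / f u)%C with (- (f w - f u) / (f w * f u))%C by (field; split; assumption).
  rewrite Cmod_div by (apply Cmult_neq_0; assumption).
  rewrite Cmod_opp, Cmod_mult. fold m.
  apply Rmult_lt_reg_r with (Cmod (f w) * m); [nra|].
  unfold Rdiv. rewrite Rmult_assoc, Rinv_l by nra. rewrite Rmult_1_r.
  eapply Rlt_trans; [exact H2|]. apply Rmult_lt_compat_l; nra.
Qed.

Lemma ccont_comp {U V : UniformSpace} (f : U -> V) (g : V -> C) (u : U) :
  continuous f u -> ccont g (f u) -> ccont (fun w => g (f w)) u.
Proof. apply continuous_comp. Qed.

Lemma ccont_pair {U : UniformSpace} (f g : U -> R) (u : U) :
  continuous f u -> continuous g u -> ccont (fun w => (f w, g w)) u.
Proof.
  intros Hf Hg. apply filterlim_locally. intros eps.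
  generalize (filter_and _ _ (proj1 (filterlim_locally _ _) Hf eps)
    (proj1 (filterlim_locally _ _) Hg eps)).
  apply filter_imp. intros w [H1 H2]. split; assumption.
Qed.

(** * Complex derivatives, in the form given by Caratheodory *)

(** With a slope function continuous at the point, the product, chain and inversion rules become
    algebraic identities plus continuity. For entire [f] the same slope function is also the
    quotient integrated in Cauchy's formula. *)
Definition cder (f : C -> C) (z l : C) : Prop :=
  exists phi : C -> C, @ccont C_UniformSpace phi z /\ phi z = l /\
    forall w, f w = (f z + phi w * (w - z))%C.

Lemma cder_eps (f : C -> C) (z l : C) :
  cder f z l <-> forall eps, 0 < eps -> exists d, 0 < d /\
    forall w, Cmod (w - z) < d -> Cmod (f w - f z - l * (w - z)) <= eps * Cmod (w - z).
Proof.
  split.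
  - intros [phi [Hc [Hl He]]] eps Heps.
    destruct (proj1 (locally_Cmod _ _) (proj1 (ccont_eps phi z) Hc eps Heps)) as [d [Hd H]].
    exists d. split; [exact Hd|]. intros w Hw. rewrite He, <- Hl.
    replace (f z + phi w * (w - z) - f z - phi z * (w - z))%C
      with ((phi w - phi z) * (w - z))%C by ring.
    rewrite Cmod_mult. apply Rmult_le_compat_r; [apply Cmod_ge_0|].
    left. apply H, Hw.
  - intros H.
    exists (fun w => if Ceq_dec w z then l else ((f w - f z) / (w - z))%C).
    split; [|split].
    + apply ccont_eps. intros eps Heps. apply locally_Cmod.
      destruct (H (eps / 2) ltac:(lra)) as [d [Hd Hw]].
      exists d. split; [exact Hd|]. intros w Hwd.
      destruct (Ceq_dec z z) as [_|n]; [|now contradict n].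
      destruct (Ceq_dec w z) as [->|n].
      * change (Cmod (Cminus l l) < eps). replace (Cminus l l) with (RtoC 0) by ring. rewrite Cmod_0. exact Heps.
      * assert (Hn : (w - z)%C <> 0%C).
        { intros E. apply n. replace w with (w - z + z)%C by ring. rewrite E. ring. }
        replace ((f w - f z) / (w - z) - l)%C
          with ((f w - f z - l * (w - z)) / (w - z))%C by (field; exact Hn).
        rewrite Cmod_div by exact Hn. apply Cmod_gt_0 in Hn.
        apply Rmult_lt_reg_r with (Cmod (w - z)); [exact Hn|].
        unfold Rdiv. rewrite Rmult_assoc, Rinv_l by lra. rewrite Rmult_1_r.
        specialize (Hw w Hwd). nra.
    + destruct (Ceq_dec z z) as [_|n]; [reflexivity|now contradict n].
    + intros w. destruct (Ceq_dec w z) as [->|n]; [ring|].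
      field. intros E. apply n. replace w with (w - z + z)%C by ring. rewrite E. ring.
Qed.

Lemma cder_ext_loc (f g : C -> C) (z l : C) :
  @locally C_UniformSpace z (fun w => f w = g w) -> cder f z l -> cder g z l.
Proof.
  intros Hloc Hf. apply cder_eps. intros eps He.
  destruct (proj1 (locally_Cmod _ _) Hloc) as [d1 [Hd1 H1]].
  destruct (proj1 (cder_eps _ _ _) Hf eps He) as [d2 [Hd2 H2]].
  exists (Rmin d1 d2). split; [apply Rmin_pos; assumption|].
  intros w Hw.
  assert (Hz : f z = g z).
  { apply H1. replace (z - z)%C with (RtoC 0) by ring. rewrite Cmod_0; exact Hd1. }
  rewrite <- Hz, <- (H1 w).
  - apply H2. eapply Rlt_le_trans; [exact Hw|apply Rmin_r].
  - eapply Rlt_le_trans; [exact Hw|apply Rmin_l].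
Qed.

Lemma cder_ext (f g : C -> C) (z l : C) :
  (forall w, f w = g w) -> cder f z l -> cder g z l.
Proof. intros H. apply cder_ext_loc. apply filter_forall, H. Qed.

Lemma cder_cont (f : C -> C) (z l : C) : cder f z l -> @ccont C_UniformSpace f z.
Proof.
  intros [phi [Hc [_ He]]].
  apply continuous_ext with (fun w => (f z + phi w * (w - z))%C); [intros; symmetry; apply He|].
  apply ccont_plus; [apply ccont_const|]. apply ccont_mult; [exact Hc|].
  apply ccont_minus; [apply ccont_id|apply ccont_const].
Qed.

Lemma cder_const (c z : C) : cder (fun _ => c) z 0.
Proof.
  exists (fun _ => 0%C). split; [apply ccont_const|]. split; [reflexivity|intros; ring].
Qed.

Lemma cder_id (z : C) : cder (fun w => w) z 1.
Proof.
  exists (fun _ => 1%C). split; [apply ccont_const|]. split; [reflexivity|intros; ring].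
Qed.

Lemma cder_plus (f g : C -> C) (z l m : C) :
  cder f z l -> cder g z m -> cder (fun w => f w + g w)%C z (l + m)%C.
Proof.
  intros [p [Hp [Hl Hf]]] [q [Hq [Hm Hg]]].
  exists (fun w => p w + q w)%C. split; [apply ccont_plus; assumption|].
  split; [rewrite Hl, Hm; reflexivity|]. intros w. rewrite Hf, Hg. ring.
Qed.

Lemma cder_mult (f g : C -> C) (z l m : C) :
  cder f z l -> cder g z m -> cder (fun w => f w * g w)%C z (l * g z + f z * m)%C.
Proof.
  intros Df Dg. assert (Cg := cder_cont _ _ _ Dg).
  destruct Df as [p [Hp [Hl Hf]]], Dg as [q [Hq [Hm Hg]]].
  exists (fun w => p w * g w + f z * q w)%C. split.
  - apply ccont_plus; apply ccont_mult; try assumption. apply ccont_const.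
  - split; [rewrite Hl, Hm; reflexivity|]. intros w. rewrite (Hf w).
    replace ((f z + p w * (w - z)) * g w)%C with (f z * g w + p w * g w * (w - z))%C by ring.
    rewrite (Hg w) at 1. ring.
Qed.

Lemma cder_opp (f : C -> C) (z l : C) : cder f z l -> cder (fun w => - f w)%C z (- l)%C.
Proof.
  intros [p [Hp [Hl Hf]]]. exists (fun w => - p w)%C. split; [apply ccont_opp; assumption|].
  split; [rewrite Hl; reflexivity|]. intros w. rewrite Hf. ring.
Qed.

Lemma cder_minus (f g : C -> C) (z l m : C) :
  cder f z l -> cder g z m -> cder (fun w => f w - g w)%C z (l - m)%C.
Proof. intros Hf Hg. apply cder_plus; [exact Hf|apply cder_opp, Hg]. Qed.

Lemma cder_inv (f : C -> C) (z l : C) :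
  cder f z l -> f z <> 0%C -> cder (fun w => / f w)%C z (- l / (f z * f z))%C.
Proof.
  intros Df Hn. assert (Cf := cder_cont _ _ _ Df).
  destruct Df as [p [Hp [Hl Hf]]].
  apply cder_ext_loc with (fun w => / f z + (- p w / (f w * f z)) * (w - z))%C.
  - generalize (ccont_ne0 f z Cf Hn). apply filter_imp. intros w Hw.
    assert (Hnw : f w <> 0%C).
    { apply Cmod_pos_ne0. apply Cmod_gt_0 in Hn. lra. }
    assert (E : (p w * (w - z) = f w - f z)%C) by (rewrite (Hf w); ring).
    replace (/ f z + - p w / (f w * f z) * (w - z))%C
      with (/ f z - (p w * (w - z)) / (f w * f z))%C by (field; split; assumption).
    rewrite E. field; split; assumption.
  - exists (fun w => - p w / (f w * f z))%C. split; [|split].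
    + apply ccont_mult; [apply ccont_opp, Hp|]. apply ccont_inv.
      * apply ccont_mult; [exact Cf|apply ccont_const].
      * apply Cmult_neq_0; exact Hn.
    + rewrite Hl. reflexivity.
    + intros w. ring_simplify (z - z)%C. ring.
Qed.

Lemma cder_unique (f : C -> C) (z l m : C) : cder f z l -> cder f z m -> l = m.
Proof.
  intros Hl Hm. apply NNPP. intros Hn.
  assert (Hp : 0 < Cmod (l - m)).
  { apply Cmod_gt_0. intros E. apply Hn. replace l with (l - m + m)%C by ring. rewrite E; ring. }
  destruct (proj1 (cder_eps _ _ _) Hl (Cmod (l - m) / 4) ltac:(lra)) as [d1 [Hd1 H1]].
  destruct (proj1 (cder_eps _ _ _) Hm (Cmod (l - m) / 4) ltac:(lra)) as [d2 [Hd2 H2]].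
  set (d := Rmin d1 d2 / 2).
  assert (Hd : 0 < Rmin d1 d2) by (apply Rmin_pos; assumption).
  assert (Hm1 : Rmin d1 d2 <= d1) by apply Rmin_l.
  assert (Hm2 : Rmin d1 d2 <= d2) by apply Rmin_r.
  assert (Hdd : Cmod (z + RtoC d - z) = d).
  { replace (z + RtoC d - z)%C with (RtoC d) by ring. rewrite Cmod_R. apply Rabs_pos_eq. unfold d; lra. }
  specialize (H1 (z + RtoC d)%C ltac:(rewrite Hdd; unfold d; lra)).
  specialize (H2 (z + RtoC d)%C ltac:(rewrite Hdd; unfold d; lra)).
  rewrite Hdd in *.
  set (u := (z + RtoC d)%C) in *.
  assert (H3 := Cmod_triangle (f u - f z - m * (u - z)) (- (f u - f z - l * (u - z)))).
  rewrite Cmod_opp in H3.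
  replace (f u - f z - m * (u - z) + - (f u - f z - l * (u - z)))%C
    with ((l - m) * (u - z))%C in H3 by ring.
  rewrite Cmod_mult, Hdd in H3.
  assert (0 < d) by (unfold d; lra). nra.
Qed.

(** The bridge to [is_derive], whose neighbourhoods come from the absolute value of [C_AbsRing];
    [locally_C] identifies them with the product neighbourhoods used here. *)
Lemma is_derive_cder (f : C -> C) (z l : C) :
  @is_derive C_AbsRing C_NormedModule f z l -> cder f z l.
Proof.
  intros [_ H]. apply cder_eps. intros eps He.
  assert (Hz : is_filter_lim (@locally (AbsRing_UniformSpace C_AbsRing) z) z) by (intros P HP; exact HP).
  assert (H1 := H z Hz (mkposreal eps He)).
  apply locally_C in H1. apply locally_Cmod in H1. destruct H1 as [d [Hd H1]].
  exists d. split; [exact Hd|]. intros w Hw. specialize (H1 w Hw).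
  rewrite (Cmult_comm l). exact H1.
Qed.

Lemma cder_is_derive (f : C -> C) (z l : C) :
  cder f z l -> @is_derive C_AbsRing C_NormedModule f z l.
Proof.
  intros H. split.
  - apply is_linear_scal_l.
  - intros x Hx.
    assert (E : z = x).
    { apply (is_filter_lim_locally_unique (K:=C_AbsRing) (V:=AbsRing_NormedModule C_AbsRing)). exact Hx. }
    rewrite <- E. intros eps. apply locally_C. apply locally_Cmod.
    destruct (proj1 (cder_eps _ _ _) H eps (cond_pos eps)) as [d [Hd H1]].
    exists d. split; [exact Hd|]. intros w Hw. specialize (H1 w Hw).
    rewrite (Cmult_comm l) in H1. exact H1.
Qed.

(** * Repeated bisection of a rectangle *)

Definition half (x0 x1 x0' x1' : R) : Prop :=
  (x0' = x0 /\ x1' = (x0 + x1) / 2) \/ (x0' = (x0 + x1) / 2 /\ x1' = x1).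

Lemma nested_halves (l r : nat -> R) :
  l 0%nat <= r 0%nat -> (forall n, half (l n) (r n) (l (S n)) (r (S n))) ->
  exists u, forall n, l n <= u <= r n /\ r n - l n = (r 0%nat - l 0%nat) / 2 ^ n /\
    l 0%nat <= l n /\ r n <= r 0%nat.
Proof.
  intros H0 Hs.
  assert (Hle : forall n, l n <= r n).
  { induction n as [|n IH]; [exact H0|]. destruct (Hs n) as [[-> ->]|[-> ->]]; lra. }
  assert (Hk : forall n k, l n <= l (n + k)%nat /\ r (n + k)%nat <= r n).
  { intros n k. induction k as [|k IH]; [rewrite Nat.add_0_r; lra|].
    rewrite Nat.add_succ_r. specialize (Hle (n + k)%nat).
    destruct (Hs (n + k)%nat) as [[-> ->]|[-> ->]]; lra. }
  assert (Hlr : forall n m, l n <= r m).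
  { intros n m. destruct (Hk n m) as [A _], (Hk m n) as [_ B].
    rewrite Nat.add_comm in B. specialize (Hle (n + m)%nat). lra. }
  destruct (completeness (fun x => exists n, x = l n)) as [u [Hu1 Hu2]].
  { exists (r 0%nat). intros x [n ->]. apply Hlr. }
  { exists (l 0%nat), 0%nat. reflexivity. }
  exists u. intros n. repeat split.
  - apply Hu1. exists n; reflexivity.
  - apply Hu2. intros x [m ->]. apply Hlr.
  - induction n as [|n IH]; [simpl; field|].
    replace ((r 0%nat - l 0%nat) / 2 ^ S n) with ((r 0%nat - l 0%nat) / 2 ^ n / 2)
      by (simpl; field; apply pow_nonzero; lra).
    rewrite <- IH. destruct (Hs n) as [[-> ->]|[-> ->]]; lra.
  - apply (Hk 0%nat n).
  - apply (Hk 0%nat n).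
Qed.

(** The compactness argument for the plane, used twice: with [P] saying that a boundary integral is
    large compared with the area it yields Goursat's theorem, and with [P] saying that the rectangle
    competes with every point it yields the maximum of a continuous function. *)
Lemma bisection (P : R -> R -> R -> R -> Prop) (a b c d : R) :
  a <= b -> c <= d ->
  (forall x0 x1 y0 y1, P x0 x1 y0 y1 -> exists x0' x1' y0' y1',
    half x0 x1 x0' x1' /\ half y0 y1 y0' y1' /\ P x0' x1' y0' y1') ->
  P a b c d ->
  exists u v, a <= u <= b /\ c <= v <= d /\
    forall n, exists x0 x1 y0 y1, P x0 x1 y0 y1 /\
      x0 <= u <= x1 /\ y0 <= v <= y1 /\
      x1 - x0 = (b - a) / 2 ^ n /\ y1 - y0 = (d - c) / 2 ^ n.
Proof.
  intros Hab Hcd Hs H0.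
  (* The halving step is only an existence statement that relies on [P]. Carrying [P] along in the
     subset type turns it into a function, which can then be iterated. *)
  pose (Q := {q : R * R * (R * R) | P (fst (fst q)) (snd (fst q)) (fst (snd q)) (snd (snd q))}).
  assert (Hstep : forall q : Q, {q' : Q |
    half (fst (fst (proj1_sig q))) (snd (fst (proj1_sig q)))
         (fst (fst (proj1_sig q'))) (snd (fst (proj1_sig q'))) /\
    half (fst (snd (proj1_sig q))) (snd (snd (proj1_sig q)))
         (fst (snd (proj1_sig q'))) (snd (snd (proj1_sig q')))}).
  { intros [[[x0 x1] [y0 y1]] Hq]. apply constructive_indefinite_description. simpl in *.
    destruct (Hs _ _ _ _ Hq) as [x0' [x1' [y0' [y1' [Hx [Hy HP]]]]]].
    exists (exist _ ((x0', x1'), (y0', y1')) HP). split; assumption. }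
  pose (s := fix s n : Q := match n with
    | O => exist _ ((a, b), (c, d)) H0 | S m => proj1_sig (Hstep (s m)) end).
  destruct (nested_halves (fun n => fst (fst (proj1_sig (s n)))) (fun n => snd (fst (proj1_sig (s n)))))
    as [u Hu]; [exact Hab| |].
  { intros n. simpl. apply (proj2_sig (Hstep (s n))). }
  destruct (nested_halves (fun n => fst (snd (proj1_sig (s n)))) (fun n => snd (snd (proj1_sig (s n)))))
    as [v Hv]; [exact Hcd| |].
  { intros n. simpl. apply (proj2_sig (Hstep (s n))). }
  exists u, v. split; [exact (proj1 (Hu 0%nat))|]. split; [exact (proj1 (Hv 0%nat))|].
  intros n. destruct (Hu n) as [Hu1 [Hu2 _]], (Hv n) as [Hv1 [Hv2 _]].
  exists (fst (fst (proj1_sig (s n)))), (snd (fst (proj1_sig (s n)))),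
    (fst (snd (proj1_sig (s n)))), (snd (snd (proj1_sig (s n)))).
  split; [exact (proj2_sig (s n))|]. repeat split; try apply Hu1; try apply Hv1; assumption.
Qed.

Lemma half_pow_small (L eps : R) : 0 < eps -> exists n, L / 2 ^ n < eps.
Proof.
  intros He. destruct (Rle_lt_dec L 0) as [HL|HL].
  { exists 0%nat. simpl. lra. }
  assert (H2 : Rabs (/ 2) < 1) by (rewrite Rabs_pos_eq; lra).
  destruct (pow_lt_1_zero (/ 2) H2 (eps / L) ltac:(apply Rdiv_lt_0_compat; lra)) as [n Hn].
  exists n. specialize (Hn n (le_n n)). rewrite Rabs_pos_eq in Hn by (apply pow_le; lra).
  rewrite pow_inv in Hn. replace eps with (L * (eps / L)) by (field; lra).
  apply Rmult_lt_compat_l; lra.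
Qed.

(** * Integrals of complex functions of a real variable *)

Definition CInt (g : R -> C) (a b : R) : C := @RInt C_R_CompleteNormedModule g a b.

Lemma ex_CInt_cont (g : R -> C) (a b : R) :
  (forall t, ccont g t) -> @ex_RInt C_R_CompleteNormedModule g a b.
Proof. intros H. apply (@ex_RInt_continuous C_R_CompleteNormedModule). intros; apply H. Qed.

Lemma CInt_correct (g : R -> C) (a b : R) :
  (forall t, ccont g t) -> @is_RInt C_R_NormedModule g a b (CInt g a b).
Proof. intros H. apply (@RInt_correct C_R_CompleteNormedModule), ex_CInt_cont, H. Qed.

Lemma CInt_unique (g : R -> C) (a b : R) (l : C) :
  @is_RInt C_R_NormedModule g a b l -> CInt g a b = l.
Proof. apply (@is_RInt_unique C_R_CompleteNormedModule). Qed.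

Lemma CInt_ext (g h : R -> C) (a b : R) : (forall t, g t = h t) -> CInt g a b = CInt h a b.
Proof. intros H. apply (@RInt_ext C_R_CompleteNormedModule). intros; apply H. Qed.

Lemma CInt_swap (g : R -> C) (a b : R) : (forall t, ccont g t) ->
  CInt g a b = (- CInt g b a)%C.
Proof.
  intros H. symmetry.
  apply (@opp_RInt_swap C_R_CompleteNormedModule), ex_CInt_cont, H.
Qed.

Lemma CInt_bound (g : R -> C) (a b M : R) : (forall t, ccont g t) ->
  (forall t, Rmin a b <= t <= Rmax a b -> Cmod (g t) <= M) ->
  Cmod (CInt g a b) <= Rabs (b - a) * M.
Proof.
  intros Hc HM.
  destruct (Rle_dec a b) as [Hab|Hab].
  - rewrite Rabs_pos_eq by lra. rewrite Cmod_norm.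
    apply (@norm_RInt_le_const C_R_NormedModule g a b).
    + exact Hab.
    + intros t Ht. rewrite <- Cmod_norm. apply HM. rewrite Rmin_left, Rmax_right; lra.
    + apply CInt_correct, Hc.
  - rewrite CInt_swap, Cmod_opp, Rabs_left by (assumption || lra).
    replace (- (b - a)) with (a - b) by ring. rewrite Cmod_norm.
    apply (@norm_RInt_le_const C_R_NormedModule g b a).
    + lra.
    + intros t Ht. rewrite <- Cmod_norm. apply HM. rewrite Rmin_right, Rmax_left; lra.
    + apply CInt_correct, Hc.
Qed.

Lemma CInt_chasles (g : R -> C) (a b c : R) : (forall t, ccont g t) ->
  CInt g a c = (CInt g a b + CInt g b c)%C.
Proof.
  intros Hc. symmetry. apply (@RInt_Chasles C_R_CompleteNormedModule); apply ex_CInt_cont, Hc.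
Qed.

Lemma CInt_point (g : R -> C) (a : R) : CInt g a a = RtoC 0.
Proof. apply (@RInt_point C_R_CompleteNormedModule). Qed.

Lemma CInt_plus (g h : R -> C) (a b : R) : (forall t, ccont g t) -> (forall t, ccont h t) ->
  CInt (fun t => g t + h t)%C a b = (CInt g a b + CInt h a b)%C.
Proof.
  intros Hg Hh. apply (@RInt_plus C_R_CompleteNormedModule); apply ex_CInt_cont; assumption.
Qed.

Lemma CInt_const (c : C) (a b : R) : CInt (fun _ => c) a b = (RtoC (b - a) * c)%C.
Proof.
  apply CInt_unique.
  replace (RtoC (b - a) * c)%C with (@scal R_AbsRing C_R_NormedModule (b - a) c).
  - apply (@is_RInt_const C_R_NormedModule).
  - destruct c as [x y]. unfold Cmult; simpl.
    apply injective_projections; simpl.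
    + change ((b - a) * x = (b - a) * x - 0 * y). ring.
    + change ((b - a) * y = (b - a) * y + 0 * x). ring.
Qed.

(** The integral is taken in C as a real vector space, so linearity over C has to be recombined from
    the two real components. *)
Lemma CInt_scal (c : C) (g : R -> C) (a b : R) : (forall t, ccont g t) ->
  CInt (fun t => c * g t)%C a b = (c * CInt g a b)%C.
Proof.
  intros Hc. apply CInt_unique. assert (H := CInt_correct g a b Hc).
  destruct (CInt g a b) as [u v] eqn:E. destruct c as [p q].
  assert (H1 : is_RInt (fun t => fst (g t)) a b u)
    by exact (@is_RInt_fct_extend_fst R_NormedModule R_NormedModule g a b (u, v) H).
  assert (H2 : is_RInt (fun t => snd (g t)) a b v)
    by exact (@is_RInt_fct_extend_snd R_NormedModule R_NormedModule g a b (u, v) H).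
  apply (@is_RInt_fct_extend_pair R_NormedModule R_NormedModule).
  - simpl. apply (is_RInt_minus (V:=R_NormedModule));
      apply (is_RInt_scal (V:=R_NormedModule)); assumption.
  - simpl. apply (is_RInt_plus (V:=R_NormedModule));
      apply (is_RInt_scal (V:=R_NormedModule)); assumption.
Qed.

Lemma CInt_minus (g h : R -> C) (a b : R) : (forall t, ccont g t) -> (forall t, ccont h t) ->
  CInt (fun t => g t - h t)%C a b = (CInt g a b - CInt h a b)%C.
Proof.
  intros Hg Hh.
  rewrite (CInt_ext _ (fun t => g t + (RtoC (-1)) * h t)%C).
  - rewrite CInt_plus, CInt_scal; [ring| | |]; intros; auto.
    apply ccont_mult; [apply ccont_const|apply Hh].
  - intros t. ring.
Qed.

(** * Derivatives along curves *)

Definition rder (g : R -> C) (t : R) (l : C) : Prop :=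
  exists phi : R -> C, ccont phi t /\ phi t = l /\
    forall s, g s = (g t + phi s * RtoC (s - t))%C.

Lemma ccont_RtoC {U : UniformSpace} (f : U -> R) (u : U) :
  continuous f u -> ccont (fun w => RtoC (f w)) u.
Proof. intros H. apply ccont_pair; [exact H|apply continuous_const]. Qed.

Lemma rder_cont (g : R -> C) (t : R) (l : C) : rder g t l -> ccont g t.
Proof.
  intros [phi [Hc [_ He]]].
  apply continuous_ext with (fun s => (g t + phi s * RtoC (s - t))%C); [intros; symmetry; apply He|].
  apply ccont_plus; [apply ccont_const|]. apply ccont_mult; [exact Hc|].
  apply ccont_RtoC. apply (continuous_minus (V:=R_NormedModule));
   [apply continuous_id|apply continuous_const].
Qed.

Lemma rder_comp (f : C -> C) (g : R -> C) (t : R) (l m : C) :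
  rder g t l -> cder f (g t) m -> rder (fun s => f (g s)) t (m * l)%C.
Proof.
  intros Dg [q [Hq [Hm Hf]]]. assert (Cg := rder_cont _ _ _ Dg).
  destruct Dg as [p [Hp [Hl Hg]]].
  exists (fun s => q (g s) * p s)%C. split.
  - apply ccont_mult; [|exact Hp]. apply ccont_comp; assumption.
  - split; [rewrite Hm, Hl; reflexivity|]. intros s. rewrite (Hf (g s)).
    replace (g s - g t)%C with (p s * RtoC (s - t))%C by (rewrite (Hg s) at 1; ring). ring.
Qed.

Lemma rder_line (z c : C) (t : R) : rder (fun s => z + RtoC s * c)%C t c.
Proof.
  exists (fun _ => c). split; [apply ccont_const|]. split; [reflexivity|].
  intros s. rewrite RtoC_minus. ring.
Qed.

Lemma rder_is_derive (g : R -> C) (t : R) (l : C) :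
  rder g t l -> @is_derive R_AbsRing C_R_NormedModule g t l.
Proof.
  intros [phi [Hc [Hl Hg]]]. split; [apply is_linear_scal_l|].
  intros x Hx. assert (E : t = x).
  { apply (is_filter_lim_locally_unique (K:=R_AbsRing) (V:=R_NormedModule)). exact Hx. }
  rewrite <- E. intros eps.
  generalize (proj1 (ccont_eps phi t) Hc eps (cond_pos eps)). apply filter_imp.
  intros s Hs.
  assert (E1 : (@minus C_R_NormedModule (@minus C_R_NormedModule (g s) (g t))
     (@scal R_AbsRing C_R_NormedModule (@minus R_NormedModule s t) l))
    = ((phi s - phi t) * RtoC (s - t))%C).
  { rewrite Hg, Hl. destruct (phi s) as [p q], (g t) as [u v], l as [c d].
    apply injective_projections.
    - change (u + (p * (s - t) - q * 0) + - u + - ((s + - t) * c)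
        = (p + - c) * (s - t) - (q + - d) * 0). ring.
    - change (v + (p * 0 + q * (s - t)) + - v + - ((s + - t) * d)
        = (p + - c) * 0 + (q + - d) * (s - t)). ring. }
  match goal with |- _ <= ?r => change r with (eps * Rabs (s - t)) end.
  refine (Rle_trans _ _ _ (Req_le _ _ (f_equal _ E1)) _).
  rewrite <- Cmod_norm, Cmod_mult, Cmod_R. apply Rmult_le_compat_r; [apply Rabs_pos|].
  left. exact Hs.
Qed.

Lemma is_derive_rder (u v : R -> R) (t du dv : R) :
  is_derive u t du -> is_derive v t dv -> rder (fun s => (u s, v s)) t (du, dv).
Proof.
  assert (K : forall (w : R -> R) (dw : R), is_derive w t dw -> exists q : R -> R, continuous q t /\ q t = dw /\
    forall s, w s = w t + q s * (s - t)).
  { intros w dw Hw. exists (fun s => if Req_EM_T s t then dw else (w s - w t) / (s - t)).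
    split; [|split].
    - apply filterlim_locally. intros eps.
      destruct Hw as [_ Hw]. assert (Ht : is_filter_lim (locally t) t) by (intros P HP; exact HP).
      specialize (Hw t Ht (mkposreal (eps / 2) (is_pos_div_2 eps))). revert Hw. apply filter_imp.
      intros s Hs. destruct (Req_EM_T t t) as [_|n]; [|now contradict n].
      destruct (Req_EM_T s t) as [->|n]; [apply ball_center|].
      change (Rabs ((w s - w t) / (s - t) - dw) < eps).
      change (Rabs (w s - w t - (s - t) * dw) <= eps / 2 * Rabs (s - t)) in Hs.
      assert (Hp : 0 < Rabs (s - t)) by (apply Rabs_pos_lt; lra).
      replace ((w s - w t) / (s - t) - dw) with ((w s - w t - (s - t) * dw) / (s - t))
        by (field; lra).
      unfold Rdiv at 1. rewrite Rabs_mult, Rabs_inv.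
      apply Rmult_lt_reg_r with (Rabs (s - t)); [exact Hp|].
      rewrite Rmult_assoc, Rinv_l by lra. assert (He := cond_pos eps). nra.
    - destruct (Req_EM_T t t) as [_|n]; [reflexivity|now contradict n].
    - intros s. change (@eq R (w s) (w t + (if Req_EM_T s t then dw else (w s - w t) / (s - t)) * (s - t))).
      destruct (Req_EM_T s t) as [->|n]; [ring|field; lra]. }
  intros Hu Hv. destruct (K u du Hu) as [p [Hp1 [Hp2 Hp3]]], (K v dv Hv) as [q [Hq1 [Hq2 Hq3]]].
  exists (fun s => (p s, q s)). split; [apply ccont_pair; assumption|].
  split; [rewrite Hp2, Hq2; reflexivity|].
  intros s. rewrite (Hp3 s), (Hq3 s). apply injective_projections; simpl.
  - change (@eq R (u t + p s * (s - t)) (u t + (p s * (s - t) - q s * 0))). ring.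
  - change (@eq R (v t + q s * (s - t)) (v t + (p s * 0 + q s * (s - t)))). ring.
Qed.

Lemma rder_Re (g : R -> C) (t : R) (l : C) :
  rder g t l -> is_derive (fun s => Re (g s)) t (Re l).
Proof.
  intros H. apply rder_is_derive in H. destruct H as [_ H]. split; [apply is_linear_scal_l|].
  intros x Hx eps. generalize (H x Hx eps). apply filter_imp. intros s Hs.
  eapply Rle_trans; [|exact Hs]. rewrite <- Cmod_norm.
  eapply Rle_trans; [|apply re_le_Cmod]. apply Req_le. reflexivity.
Qed.

Lemma CInt_rder (g dg : R -> C) (a b : R) :
  (forall t, rder g t (dg t)) -> (forall t, ccont dg t) ->
  CInt dg a b = (g b - g a)%C.
Proof.
  intros H Hc. apply CInt_unique.
  apply (@is_RInt_derive C_R_CompleteNormedModule g dg).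
  - intros; apply rder_is_derive, H.
  - intros; apply Hc.
Qed.

(** * Goursat's theorem and primitives *)

Definition cont_all (f : C -> C) : Prop := forall z, @ccont C_UniformSpace f z.

Definition hint (f : C -> C) (y x0 x1 : R) : C := CInt (fun t => f (t, y)) x0 x1.
Definition vint (f : C -> C) (x y0 y1 : R) : C := CInt (fun t => f (x, t)) y0 y1.

(** The integral of f(z) dz along the boundary, counterclockwise if [x0 < x1] and [y0 < y1]. The
    bounds need not be ordered; exchanging a pair changes the sign, so cuts may be made anywhere. *)
Definition rect (f : C -> C) (x0 x1 y0 y1 : R) : C :=
  (hint f y0 x0 x1 + Ci * vint f x1 y0 y1 - hint f y1 x0 x1 - Ci * vint f x0 y0 y1)%C.

Lemma hcont (f : C -> C) (y : R) : cont_all f -> forall t, ccont (fun t => f (t, y)) t.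
Proof.
  intros H t. apply (ccont_comp (V:=C_UniformSpace) (fun t => (t, y)) f); [|apply H].
  apply ccont_pair; [apply continuous_id|apply continuous_const].
Qed.

Lemma vcont (f : C -> C) (x : R) : cont_all f -> forall t, ccont (fun t => f (x, t)) t.
Proof.
  intros H t. apply (ccont_comp (V:=C_UniformSpace) (fun t => (x, t)) f); [|apply H].
  apply ccont_pair; [apply continuous_const|apply continuous_id].
Qed.

Lemma cder_cont_all (F f : C -> C) : (forall z, cder F z (f z)) -> cont_all F.
Proof. intros H z. exact (cder_cont F z (f z) (H z)). Qed.

Lemma hint_prim (F f : C -> C) (y x0 x1 : R) :
  (forall z, cder F z (f z)) -> cont_all f -> hint f y x0 x1 = (F (x1, y) - F (x0, y))%C.
Proof.
  intros HF Hf. apply (CInt_rder (fun t => F (t, y))); [|apply hcont, Hf].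
  intros t. replace (f (t, y)) with (f (t, y) * (1, 0))%C.
  - apply rder_comp with (g := fun t => (t, y)); [|apply HF].
    exists (fun _ => (1, 0)). split; [apply ccont_const|]. split; [reflexivity|].
    intros s. apply injective_projections; simpl; ring.
  - change (1, 0) with (RtoC 1). ring.
Qed.

Lemma vint_prim (F f : C -> C) (x y0 y1 : R) :
  (forall z, cder F z (f z)) -> cont_all f -> (Ci * vint f x y0 y1 = F (x, y1) - F (x, y0))%C.
Proof.
  intros HF Hf. unfold vint. rewrite <- CInt_scal by apply vcont, Hf.
  apply (CInt_rder (fun t => F (x, t))).
  - intros t. rewrite Cmult_comm.
    apply rder_comp with (g := fun t => (x, t)); [|apply HF].
    exists (fun _ => Ci). split; [apply ccont_const|]. split; [reflexivity|].
    intros s. apply injective_projections; simpl; ring.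
  - intros t. apply ccont_mult; [apply ccont_const|apply vcont, Hf].
Qed.

Lemma rect_prim (F f : C -> C) (x0 x1 y0 y1 : R) :
  (forall z, cder F z (f z)) -> cont_all f -> rect f x0 x1 y0 y1 = RtoC 0.
Proof.
  intros HF Hf. unfold rect.
  rewrite !(hint_prim F f), !(vint_prim F f) by assumption. ring.
Qed.

Lemma rect_minus (f g : C -> C) (x0 x1 y0 y1 : R) : cont_all f -> cont_all g ->
  rect (fun z => f z - g z)%C x0 x1 y0 y1 = (rect f x0 x1 y0 y1 - rect g x0 x1 y0 y1)%C.
Proof.
  intros Hf Hg. unfold rect, hint, vint.
  rewrite !CInt_minus by (apply hcont || apply vcont; assumption). ring.
Qed.

Lemma rect_split_x (f : C -> C) (x0 x1 x2 y0 y1 : R) : cont_all f ->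
  rect f x0 x2 y0 y1 = (rect f x0 x1 y0 y1 + rect f x1 x2 y0 y1)%C.
Proof.
  intros Hf. unfold rect, hint. rewrite !(CInt_chasles _ x0 x1 x2) by apply hcont, Hf. ring.
Qed.

Lemma rect_split_y (f : C -> C) (x0 x1 y0 y1 y2 : R) : cont_all f ->
  rect f x0 x1 y0 y2 = (rect f x0 x1 y0 y1 + rect f x0 x1 y1 y2)%C.
Proof.
  intros Hf. unfold rect, vint. rewrite !(CInt_chasles _ y0 y1 y2) by apply vcont, Hf. ring.
Qed.

Lemma rect_flat_x (f : C -> C) (x y0 y1 : R) : rect f x x y0 y1 = RtoC 0.
Proof. unfold rect, hint. rewrite !CInt_point. ring. Qed.

Lemma rect_flat_y (f : C -> C) (x0 x1 y : R) : rect f x0 x1 y y = RtoC 0.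
Proof. unfold rect, vint. rewrite !CInt_point. ring. Qed.

Lemma rect_swap_x (f : C -> C) (x0 x1 y0 y1 : R) : cont_all f ->
  rect f x0 x1 y0 y1 = (- rect f x1 x0 y0 y1)%C.
Proof.
  intros Hf. assert (H := rect_split_x f x0 x1 x0 y0 y1 Hf). rewrite rect_flat_x in H.
  replace (rect f x0 x1 y0 y1) with
    (rect f x0 x1 y0 y1 + rect f x1 x0 y0 y1 - rect f x1 x0 y0 y1)%C by ring.
  rewrite <- H. ring.
Qed.

Lemma rect_swap_y (f : C -> C) (x0 x1 y0 y1 : R) : cont_all f ->
  rect f x0 x1 y0 y1 = (- rect f x0 x1 y1 y0)%C.
Proof.
  intros Hf. assert (H := rect_split_y f x0 x1 y0 y1 y0 Hf). rewrite rect_flat_y in H.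
  replace (rect f x0 x1 y0 y1) with
    (rect f x0 x1 y0 y1 + rect f x0 x1 y1 y0 - rect f x0 x1 y1 y0)%C by ring.
  rewrite <- H. ring.
Qed.

Lemma Rmin_Rmax_in (a b : R) : (Rmin a b <= a <= Rmax a b) /\ (Rmin a b <= b <= Rmax a b).
Proof. repeat split; [apply Rmin_l|apply Rmax_l|apply Rmin_r|apply Rmax_r]. Qed.

Lemma rect_bound (f : C -> C) (x0 x1 y0 y1 M : R) : cont_all f ->
  (forall s t, Rmin x0 x1 <= s <= Rmax x0 x1 -> Rmin y0 y1 <= t <= Rmax y0 y1 ->
    Cmod (f (s, t)) <= M) ->
  Cmod (rect f x0 x1 y0 y1) <= 2 * (Rabs (x1 - x0) + Rabs (y1 - y0)) * M.
Proof.
  intros Hf HM. unfold rect.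
  destruct (Rmin_Rmax_in x0 x1) as [Hx0 Hx1], (Rmin_Rmax_in y0 y1) as [Hy0 Hy1].
  assert (Hh : forall y, Rmin y0 y1 <= y <= Rmax y0 y1 ->
    Cmod (hint f y x0 x1) <= Rabs (x1 - x0) * M).
  { intros y Hy. apply CInt_bound; [apply hcont, Hf|]. intros; apply HM; assumption. }
  assert (Hv : forall x, Rmin x0 x1 <= x <= Rmax x0 x1 ->
    Cmod (Ci * vint f x y0 y1) <= Rabs (y1 - y0) * M).
  { intros x Hx. rewrite Cmod_mult, Cmod_Ci, Rmult_1_l.
    apply CInt_bound; [apply vcont, Hf|]. intros; apply HM; assumption. }
  assert (A1 := Hh y0 Hy0). assert (A2 := Hh y1 Hy1).
  assert (A3 := Hv x0 Hx0). assert (A4 := Hv x1 Hx1).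
  assert (B1 := Cmod_triangle (hint f y0 x0 x1 + Ci * vint f x1 y0 y1 - hint f y1 x0 x1)
    (- (Ci * vint f x0 y0 y1))).
  assert (B2 := Cmod_triangle (hint f y0 x0 x1 + Ci * vint f x1 y0 y1) (- hint f y1 x0 x1)).
  assert (B3 := Cmod_triangle (hint f y0 x0 x1) (Ci * vint f x1 y0 y1)).
  rewrite Cmod_opp in B1, B2. unfold Cminus in *. lra.
Qed.

Lemma Cmod_le_sum (x y : R) : Cmod (x, y) <= Rabs x + Rabs y.
Proof.
  assert (H := Cmod_triangle (RtoC x) (Ci * RtoC y)).
  rewrite Cmod_mult, Cmod_Ci, !Cmod_R in H.
  replace (RtoC x + Ci * RtoC y)%C with (x, y) in H; [lra|].
  apply injective_projections; simpl; ring.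
Qed.

Lemma goursat (f : C -> C) (x0 x1 y0 y1 : R) : cont_all f -> x0 < x1 -> y0 < y1 ->
  (forall s t, x0 <= s <= x1 -> y0 <= t <= y1 -> exists l, cder f (s, t) l) ->
  rect f x0 x1 y0 y1 = RtoC 0.
Proof.
  intros Hf Hx Hy Hd. apply NNPP. intros Hn. apply Cmod_gt_0 in Hn.
  set (W := x1 - x0). set (H := y1 - y0).
  assert (HW : 0 < W) by (unfold W; lra). assert (HH : 0 < H) by (unfold H; lra).
  assert (HWH : 0 < W * H) by (apply Rmult_lt_0_compat; assumption).
  (* The modulus of the integral per unit area. Of four quadrants at least one keeps this ratio, so
     bisection never loses it. *)
  set (eps := Cmod (rect f x0 x1 y0 y1) / (W * H)).
  assert (He : 0 < eps) by (apply Rdiv_lt_0_compat; assumption).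
  destruct (bisection (fun a b c d => a <= b /\ c <= d /\
     eps * ((b - a) * (d - c)) <= Cmod (rect f a b c d)) x0 x1 y0 y1)
    as [u [v [Hu [Hv Hn']]]].
  - lra.
  - lra.
  - intros a b c d [Hab [Hcd HP]]. apply NNPP. intros Hno.
    set (m := (a + b) / 2). set (k := (c + d) / 2).
    assert (N : forall a' b' c' d', half a b a' b' -> half c d c' d' ->
      Cmod (rect f a' b' c' d') < eps * ((b - a) / 2 * ((d - c) / 2))).
    { intros a' b' c' d' H1 H2. apply Rnot_le_lt. intros H3. apply Hno.
      exists a', b', c', d'. split; [exact H1|]. split; [exact H2|].
      destruct H1 as [[-> ->]|[-> ->]], H2 as [[-> ->]|[-> ->]];
      (split; [lra|]; split; [lra|]; eapply Rle_trans; [|exact H3]; apply Req_le; field). }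
    assert (N1 := N a m c k ltac:(left; split; reflexivity) ltac:(left; split; reflexivity)).
    assert (N2 := N a m k d ltac:(left; split; reflexivity) ltac:(right; split; reflexivity)).
    assert (N3 := N m b c k ltac:(right; split; reflexivity) ltac:(left; split; reflexivity)).
    assert (N4 := N m b k d ltac:(right; split; reflexivity) ltac:(right; split; reflexivity)).
    rewrite (rect_split_x f a m b c d Hf), (rect_split_y f a m c k d Hf),
      (rect_split_y f m b c k d Hf) in HP.
    assert (T1 := Cmod_triangle (rect f a m c k + rect f a m k d) (rect f m b c k + rect f m b k d)).
    assert (T2 := Cmod_triangle (rect f a m c k) (rect f a m k d)).
    assert (T3 := Cmod_triangle (rect f m b c k) (rect f m b k d)).
    nra.
  - split; [lra|]. split; [lra|]. fold W H. unfold eps. apply Req_le. field. lra.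
  - destruct (Hd u v Hu Hv) as [l Hl].
    set (S := (W + H) * (W + H)).
    assert (HS : 0 < S) by (apply Rmult_lt_0_compat; lra).
    (* Chosen so that the upper bound 2 S e / 4^n for the integral over the n-th rectangle is half
       of the lower bound eps W H / 4^n. *)
    set (e := eps * (W * H) / (4 * S)).
    assert (He' : 0 < e).
    { apply Rdiv_lt_0_compat; [apply Rmult_lt_0_compat; assumption|lra]. }
    destruct (proj1 (cder_eps _ _ _) Hl e He') as [d [Hdp Hdd]].
    destruct (half_pow_small (W + H) d Hdp) as [n Hpn].
    destruct (Hn' n) as [a [b [c [k [[Hab [Hck HP]] [Hua [Hvc [Ew Eh]]]]]]]].
    fold W in Ew. fold H in Eh.
    assert (Hp2 : 0 < 2 ^ n) by (apply pow_lt; lra).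
    (* The affine approximation at the limit point has a quadratic primitive, so its boundary
       integral vanishes and only the error f - g contributes. *)
    set (g := fun z => (f (u, v) + l * (z - (u, v)))%C).
    assert (Hg : forall z, cder g z l).
    { intros z. exists (fun _ => l). split; [apply ccont_const|]. split; [reflexivity|].
      intros w. unfold g. ring. }
    assert (Hgc : cont_all g) by (intros z; exact (cder_cont _ _ _ (Hg z))).
    assert (HG : forall z, cder (fun z => f (u, v) * z + l * ((z - (u, v)) * (z - (u, v)) / 2))%C z (g z)).
    { intros z.
      exists (fun w => f (u, v) + l * ((w - (u, v)) + (z - (u, v))) / 2)%C. split; [|split].
      - apply ccont_plus; [apply ccont_const|]. apply ccont_mult; [|apply ccont_const].
        apply ccont_mult; [apply ccont_const|].
        apply ccont_plus; [|apply ccont_const]. apply ccont_minus; [apply ccont_id|apply ccont_const].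
      - unfold g. field.
      - intros w. field. }
    assert (E0 := rect_minus f g a b c k Hf Hgc).
    rewrite (rect_prim _ g a b c k HG Hgc) in E0.
    replace (rect f a b c k - 0)%C with (rect f a b c k) in E0 by ring.
    rewrite <- E0 in HP.
    assert (HB : Cmod (rect (fun z => f z - g z)%C a b c k)
      <= 2 * (Rabs (b - a) + Rabs (k - c)) * (e * ((W + H) / 2 ^ n))).
    { apply rect_bound.
      - intros z. apply ccont_minus; [apply Hf|apply Hgc].
      - intros s t. rewrite Rmin_left, Rmax_right, Rmin_left, Rmax_right by lra. intros Hs Ht.
        assert (Hdist : Cmod ((s, t) - (u, v)) <= (W + H) / 2 ^ n).
        { replace ((W + H) / 2 ^ n) with ((b - a) + (k - c)) by (rewrite Ew, Eh; field; lra).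
          eapply Rle_trans; [apply Cmod_le_sum|]. simpl. apply Rplus_le_compat; apply Rabs_le; lra. }
        replace (f (s, t) - g (s, t))%C with (f (s, t) - f (u, v) - l * ((s, t) - (u, v)))%C
          by (unfold g; ring).
        eapply Rle_trans; [apply Hdd; lra|]. apply Rmult_le_compat_l; lra. }
    rewrite !Rabs_pos_eq, Ew, Eh in HB by lra. rewrite Ew, Eh in HP.
    assert (HF := Rle_trans _ _ _ HP HB).
    assert (E1 : eps * (W / 2 ^ n * (H / 2 ^ n)) = eps * (W * H) * (/ 2 ^ n * / 2 ^ n)) by (field; lra).
    assert (E2 : 2 * (W / 2 ^ n + H / 2 ^ n) * (e * ((W + H) / 2 ^ n))
      = eps * (W * H) / 2 * (/ 2 ^ n * / 2 ^ n)) by (unfold e, S; field; lra).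
    rewrite E1, E2 in HF.
    apply Rmult_le_reg_r in HF; [nra|]. apply Rmult_lt_0_compat; apply Rinv_0_lt_compat; lra.
Qed.

Lemma goursat_unordered (f : C -> C) (x0 x1 y0 y1 : R) : cont_all f ->
  (forall s t, Rmin x0 x1 <= s <= Rmax x0 x1 -> Rmin y0 y1 <= t <= Rmax y0 y1 ->
    exists l, cder f (s, t) l) ->
  rect f x0 x1 y0 y1 = RtoC 0.
Proof.
  intros Hf.
  assert (K : forall a b c d, a <= b -> c <= d ->
    (forall s t, a <= s <= b -> c <= t <= d -> exists l, cder f (s, t) l) ->
    rect f a b c d = RtoC 0).
  { intros a b c d [Hab| ->] [Hcd| ->] H; try apply rect_flat_x; try apply rect_flat_y.
    apply goursat; assumption. }
  destruct (Rle_lt_dec x0 x1) as [Hx|Hx], (Rle_lt_dec y0 y1) as [Hy|Hy].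
  - rewrite !Rmin_left, !Rmax_right by lra. apply K; lra.
  - rewrite Rmin_left, Rmax_right, Rmin_right, Rmax_left by lra. intros H.
    rewrite rect_swap_y, K by (assumption || lra). ring.
  - rewrite Rmin_right, Rmax_left, Rmin_left, Rmax_right by lra. intros H.
    rewrite rect_swap_x, K by (assumption || lra). ring.
  - rewrite !Rmin_right, !Rmax_left by lra. intros H.
    rewrite rect_swap_x, rect_swap_y, K by (assumption || lra). ring.
Qed.

(** Cutting off the pieces that avoid the exceptional corner shows that the integral equals the one
    over any similar smaller rectangle at that corner. There [f] is bounded, by continuity, while
    the perimeter tends to 0. *)
Lemma goursat_corner (f : C -> C) (a b x y : R) : cont_all f ->
  (forall z, z <> (a, b) -> exists l, cder f z l) ->
  rect f a x b y = RtoC 0.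
Proof.
  intros Hf Hd.
  destruct (Req_EM_T x a) as [->|Hx]; [apply rect_flat_x|].
  destruct (Req_EM_T y b) as [->|Hy]; [apply rect_flat_y|].
  assert (Hs : forall s, 0 < s < 1 ->
    rect f a x b y = rect f a (a + s * (x - a)) b (b + s * (y - b))).
  { intros s Hs. rewrite (rect_split_x f a (a + s * (x - a)) x) by exact Hf.
    rewrite (rect_split_y f a (a + s * (x - a)) b (b + s * (y - b)) y) by exact Hf.
    assert (Ns : forall p q, q <> p -> ~ Rmin (p + s * (q - p)) q <= p <= Rmax (p + s * (q - p)) q).
    { intros p q Hpq. destruct (Rle_lt_dec q p).
      - rewrite Rmin_right, Rmax_left by nra. nra.
      - rewrite Rmin_left, Rmax_right by nra. nra. }
    rewrite (goursat_unordered f (a + s * (x - a)) x b y Hf).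
    - rewrite (goursat_unordered f a (a + s * (x - a)) (b + s * (y - b)) y Hf); [ring|].
      intros p q Hp Hq. apply Hd. intros E. injection E as -> ->. exact (Ns b y Hy Hq).
    - intros p q Hp Hq. apply Hd. intros E. injection E as -> ->. exact (Ns a x Hx Hp). }
  apply NNPP. intros Hn. apply Cmod_gt_0 in Hn. set (A := Cmod (rect f a x b y)) in *.
  destruct (proj1 (locally_Cmod _ _) (proj1 (ccont_eps f (a, b)) (Hf (a, b)) 1 Rlt_0_1))
    as [d [Hdp Hdd]].
  set (M := Cmod (f (a, b)) + 1).
  assert (HM : 0 < M) by (unfold M; assert (H := Cmod_ge_0 (f (a, b))); lra).
  set (L := Rabs (x - a) + Rabs (y - b)).
  assert (HL : 0 < L).
  { unfold L. assert (H1 : 0 < Rabs (x - a)) by (apply Rabs_pos_lt; lra).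
    assert (H2 := Rabs_pos (y - b)). lra. }
  (* The shrinking factor s has to keep the small rectangle in the disc where |f| <= M, and to make
     the bound 2 s L M smaller than A. *)
  destruct (half_pow_small 1 (Rmin (1 / 2) (Rmin (d / L) (A / (2 * L * M))))) as [n Hpn].
  { repeat apply Rmin_pos; try lra; apply Rdiv_lt_0_compat; try lra.
    apply Rmult_lt_0_compat; lra. }
  set (s := 1 / 2 ^ n) in *.
  assert (H2n : 0 < 2 ^ n) by (apply pow_lt; lra).
  assert (Hs0 : 0 < s) by (apply Rdiv_lt_0_compat; lra).
  assert (S1 : s < 1 / 2) by (eapply Rlt_le_trans; [exact Hpn|apply Rmin_l]).
  assert (S2 : s < d / L).
  { eapply Rlt_le_trans; [exact Hpn|]. eapply Rle_trans; [apply Rmin_r|apply Rmin_l]. }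
  assert (S3 : s < A / (2 * L * M)).
  { eapply Rlt_le_trans; [exact Hpn|]. eapply Rle_trans; [apply Rmin_r|apply Rmin_r]. }
  assert (HsL : s * L < d).
  { apply Rmult_lt_compat_r with (r := L) in S2; [|exact HL].
    replace (d / L * L) with d in S2 by (field; lra). exact S2. }
  assert (HsA : s * (2 * L * M) < A).
  { assert (0 < 2 * L * M) by (apply Rmult_lt_0_compat; lra).
    apply Rmult_lt_compat_r with (r := 2 * L * M) in S3; [|lra].
    replace (A / (2 * L * M) * (2 * L * M)) with A in S3 by (field; lra). exact S3. }
  assert (HB : A <= 2 * (Rabs (a + s * (x - a) - a) + Rabs (b + s * (y - b) - b)) * M).
  { unfold A. rewrite (Hs s) by lra. apply rect_bound; [exact Hf|].
    assert (Bd : forall p q r, Rmin p (p + s * (q - p)) <= r <= Rmax p (p + s * (q - p)) ->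
      Rabs (r - p) <= s * Rabs (q - p)).
    { intros p q r Hr. rewrite <- (Rabs_pos_eq s) by lra. rewrite <- Rabs_mult.
      destruct (Rle_lt_dec 0 (s * (q - p))).
      - rewrite Rmin_left, Rmax_right in Hr by lra. rewrite !Rabs_pos_eq by lra. lra.
      - rewrite Rmin_right, Rmax_left in Hr by lra. rewrite (Rabs_left (s * (q - p))) by lra.
        rewrite Rabs_left1; lra. }
    intros p q Hp Hq. apply Bd in Hp. apply Bd in Hq.
    assert (Hc : Cmod ((p, q) - (a, b)) < d).
    { eapply Rle_lt_trans; [apply Cmod_le_sum|]. unfold L in HsL. simpl. 
      fold (p - a) (q - b). lra. }
    specialize (Hdd _ Hc). assert (T := Cmod_triangle (f (p, q) - f (a, b)) (f (a, b))).
    replace (f (p, q) - f (a, b) + f (a, b))%C with (f (p, q)) in T by ring. unfold M. lra. }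
  replace (a + s * (x - a) - a) with (s * (x - a)) in HB by ring.
  replace (b + s * (y - b) - b) with (s * (y - b)) in HB by ring.
  rewrite !Rabs_mult, !(Rabs_pos_eq s) in HB by lra. unfold L in HsA. nra.
Qed.

(** Cutting at the coordinates of [z0] makes it a corner of all four pieces. The cuts may fall
    outside the rectangle, which is harmless since [rect] is additive for unordered bounds. *)
Lemma goursat_except (f : C -> C) (z0 : C) (x0 x1 y0 y1 : R) : cont_all f ->
  (forall z, z <> z0 -> exists l, cder f z l) ->
  rect f x0 x1 y0 y1 = RtoC 0.
Proof.
  intros Hf. destruct z0 as [a b]. intros Hd.
  rewrite (rect_split_x f x0 a x1), (rect_split_y f x0 a y0 b y1),
    (rect_split_y f a x1 y0 b y1) by exact Hf.
  rewrite (rect_swap_y f a x1 y0 b), (rect_swap_y f x0 a y0 b), !(rect_swap_x f x0 a) by exact Hf.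
  rewrite !goursat_corner by assumption. ring.
Qed.

(** The primitive integrates [f] from 0 along the real axis and then vertically. The vanishing of
    [rect] between the heights 0 and y turns its increment into an integral over a short broken line
    starting at (x, y), where [f] is nearly constant. *)
Lemma primitive_of_rect_zero (f : C -> C) : cont_all f ->
  (forall x0 x1 y0 y1, rect f x0 x1 y0 y1 = RtoC 0) ->
  exists F, forall z, cder F z (f z).
Proof.
  intros Hf Hr. exists (fun z => hint f 0 0 (fst z) + Ci * vint f (fst z) 0 (snd z))%C.
  intros [x y]. apply cder_eps. intros eps He.
  destruct (proj1 (locally_Cmod _ _) (proj1 (ccont_eps f (x, y)) (Hf (x, y)) (eps / 2) ltac:(lra)))
    as [d [Hdp Hdd]].
  exists (d / 2). split; [lra|]. intros [x' y'] Hw. simpl fst; simpl snd.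
  set (r := Cmod ((x', y') - (x, y))) in *.
  assert (Hr1 : Rabs (x' - x) <= r) by exact (re_le_Cmod ((x', y') - (x, y))).
  assert (Hr2 : Rabs (y' - y) <= r)
    by exact (Rle_trans _ _ _ (Rmax_r _ _) (Rmax_Cmod ((x', y') - (x, y))%C)).
  assert (E : (hint f 0 0 x' + Ci * vint f x' 0 y' - (hint f 0 0 x + Ci * vint f x 0 y)
     - f (x, y) * ((x', y') - (x, y)))%C =
    (CInt (fun t => f (t, y) - f (x, y)) x x' + Ci * CInt (fun t => f (x', t) - f (x, y)) y y')%C).
  { rewrite !CInt_minus, !CInt_const by (intros; apply ccont_const || apply hcont, Hf || apply vcont, Hf).
    fold (hint f y x x') (vint f x' y y').
    assert (H1 := Hr x x' 0 y). unfold rect in H1.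
    assert (H2 : hint f 0 0 x' = (hint f 0 0 x + hint f 0 x x')%C) by apply CInt_chasles, hcont, Hf.
    assert (H3 : vint f x' 0 y' = (vint f x' 0 y + vint f x' y y')%C) by apply CInt_chasles, vcont, Hf.
    assert (H4 : ((x', y') - (x, y))%C = (RtoC (x' - x) + Ci * RtoC (y' - y))%C)
      by (apply injective_projections; simpl; ring).
    rewrite H2, H3, H4.
    replace (hint f y x x') with (hint f 0 x x' + Ci * vint f x' 0 y - Ci * vint f x 0 y
      - (hint f 0 x x' + Ci * vint f x' 0 y - hint f y x x' - Ci * vint f x 0 y))%C by ring.
    rewrite H1. ring. }
  rewrite E.
  assert (Bd : forall p q t, Rmin p q <= t <= Rmax p q -> Rabs (t - p) <= Rabs (q - p)).
  { intros p q t Ht. destruct (Rle_lt_dec p q).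
    - rewrite Rmin_left, Rmax_right in Ht by lra. rewrite !Rabs_pos_eq; lra.
    - rewrite Rmin_right, Rmax_left in Ht by lra. rewrite !Rabs_left1; lra. }
  assert (B1 : Cmod (CInt (fun t => f (t, y) - f (x, y))%C x x') <= Rabs (x' - x) * (eps / 2)).
  { apply CInt_bound.
    - intros. apply ccont_minus; [apply hcont, Hf|apply ccont_const].
    - intros t Ht. apply Bd in Ht. left. apply Hdd.
      eapply Rle_lt_trans; [apply Cmod_le_sum|]. simpl. rewrite Rplus_opp_r, Rabs_R0.
      fold (t - x). lra. }
  assert (B2 : Cmod (CInt (fun t => f (x', t) - f (x, y))%C y y') <= Rabs (y' - y) * (eps / 2)).
  { apply CInt_bound.
    - intros. apply ccont_minus; [apply vcont, Hf|apply ccont_const].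
    - intros t Ht. apply Bd in Ht. left. apply Hdd.
      eapply Rle_lt_trans; [apply Cmod_le_sum|]. simpl.
      fold (x' - x) (t - y). lra. }
  eapply Rle_trans; [apply Cmod_triangle|]. rewrite Cmod_mult, Cmod_Ci. nra.
Qed.

(** * Cauchy's formula and its consequences *)

Definition holo (f : C -> C) : Prop := forall z, exists l, cder f z l.

Lemma holo_cont (f : C -> C) : holo f -> cont_all f.
Proof. intros H z. destruct (H z) as [l Hl]. exact (cder_cont _ _ _ Hl). Qed.

Lemma Csub_ne0 (z w : C) : z <> w -> (z - w)%C <> RtoC 0.
Proof. intros H E. apply H. replace z with (z - w + w)%C by ring. rewrite E. ring. Qed.

(** The slope function of [f] at [w] is differentiable away from [w] but so far only continuous at
    [w]; Goursat's theorem with an exceptional point still gives it a primitive. This yields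
    Cauchy's formula at once, and later the differentiability of [q] at [w]. *)
Lemma quotient_primitive (f : C -> C) (w : C) : holo f ->
  exists q Q : C -> C, (forall z, f z = (f w + q z * (z - w))%C) /\
    cder f w (q w) /\ cont_all q /\ forall z, cder Q z (q z).
Proof.
  intros Hf. destruct (Hf w) as [l Hl]. assert (Hl' := Hl).
  destruct Hl as [q [Hq [Hql He]]]. exists q.
  assert (Hd : forall z, z <> w -> exists m, cder q z m).
  { intros z Hz. destruct (Hf z) as [m Hm].
    eexists. apply cder_ext_loc with (fun u => (f u - f w) * / (u - w))%C.
    - assert (Hp := proj1 (Cmod_gt_0 _) (Csub_ne0 z w Hz)).
      apply locally_Cmod. exists (Cmod (z - w)). split; [exact Hp|]. intros u Hu.
      assert (Hn : u <> w).
      { intros ->. replace (w - z)%C with (- (z - w))%C in Hu by ring. rewrite Cmod_opp in Hu. lra. }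
      rewrite (He u). field. apply Csub_ne0, Hn.
    - apply cder_mult.
      + apply cder_minus; [exact Hm|apply cder_const].
      + apply cder_inv; [apply cder_minus; [apply cder_id|apply cder_const]|].
        apply Csub_ne0, Hz. }
  assert (Hc : cont_all q).
  { intros z. destruct (Ceq_dec z w) as [->|n]; [exact Hq|].
    destruct (Hd z n) as [m Hm]. exact (cder_cont _ _ _ Hm). }
  destruct (primitive_of_rect_zero q Hc) as [Q HQ].
  { intros. apply goursat_except with w; assumption. }
  exists Q. rewrite Hql. repeat split; assumption.
Qed.

Definition expi (t : R) : C := (cos t, sin t).
Definition circ (w0 : C) (r t : R) : C := (w0 + RtoC r * expi t)%C.
Definition dcirc (r t : R) : C := (RtoC r * (Ci * expi t))%C.

Lemma expi_rder (t : R) : rder expi t (Ci * expi t)%C.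
Proof.
  replace (Ci * expi t)%C with (- sin t, cos t)
    by (apply injective_projections; simpl; ring).
  apply is_derive_rder; auto_derive; trivial; ring.
Qed.

Lemma expi_mod (t : R) : Cmod (expi t) = 1.
Proof.
  unfold Cmod, expi; simpl. rewrite !Rmult_1_r.
  rewrite Rplus_comm. fold (Rsqr (sin t)) (Rsqr (cos t)). rewrite sin2_cos2. apply sqrt_1.
Qed.

Lemma circ_rder (w0 : C) (r t : R) : rder (circ w0 r) t (dcirc r t).
Proof.
  destruct (expi_rder t) as [p [Hp [Hl He]]].
  exists (fun s => RtoC r * p s)%C. split; [apply ccont_mult; [apply ccont_const|exact Hp]|].
  split; [unfold dcirc; rewrite Hl; reflexivity|]. intros s. unfold circ. rewrite (He s). ring.
Qed.

Lemma circ_cont (w0 : C) (r t : R) : ccont (circ w0 r) t.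
Proof. exact (rder_cont _ _ _ (circ_rder w0 r t)). Qed.

Lemma dcirc_cont (r t : R) : ccont (dcirc r) t.
Proof.
  apply ccont_mult; [apply ccont_const|]. apply ccont_mult; [apply ccont_const|].
  exact (rder_cont _ _ _ (expi_rder t)).
Qed.

Lemma circ_comp_cont (f : C -> C) (w0 : C) (r t : R) :
  cont_all f -> ccont (fun t => f (circ w0 r t)) t.
Proof.
  intros H. apply (ccont_comp (V:=C_UniformSpace) (circ w0 r) f); [apply circ_cont|apply H].
Qed.

Lemma circ_closed (w0 : C) (r : R) : circ w0 r (2 * PI) = circ w0 r 0.
Proof. unfold circ, expi. rewrite cos_2PI, sin_2PI, cos_0, sin_0. reflexivity. Qed.

Lemma circ_int_prim (Q q : C -> C) (w0 : C) (r : R) : cont_all q ->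
  (forall z, cder Q z (q z)) -> CInt (fun t => q (circ w0 r t) * dcirc r t)%C 0 (2 * PI) = RtoC 0.
Proof.
  intros Hq HQ. rewrite (CInt_rder (fun t => Q (circ w0 r t))).
  - rewrite circ_closed. ring.
  - intros t. apply rder_comp; [apply circ_rder|apply HQ].
  - intros t. apply ccont_mult; [apply circ_comp_cont, Hq|apply dcirc_cont].
Qed.

Lemma circ_dist (w0 w : C) (r t : R) : 0 <= r ->
  r - Cmod (w - w0) <= Cmod (circ w0 r t - w) <= r + Cmod (w - w0).
Proof.
  intros Hr. unfold circ.
  assert (E : Cmod (RtoC r * expi t) = r) by (rewrite Cmod_mult, Cmod_R, expi_mod, Rabs_pos_eq; lra).
  assert (H1 := Cmod_triangle (w0 + RtoC r * expi t - w) (w - w0)).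
  replace (w0 + RtoC r * expi t - w + (w - w0))%C with (RtoC r * expi t)%C in H1 by ring.
  assert (H2 := Cmod_triangle (RtoC r * expi t) (- (w - w0))). rewrite Cmod_opp in H2.
  replace (RtoC r * expi t + - (w - w0))%C with (w0 + RtoC r * expi t - w)%C in H2 by ring. lra.
Qed.

Lemma circ_ne0 (w0 w : C) (r t : R) : Cmod (w - w0) < r -> (circ w0 r t - w)%C <> RtoC 0.
Proof.
  intros H. apply Cmod_pos_ne0. assert (H0 := Cmod_ge_0 (w - w0)).
  assert (H1 := circ_dist w0 w r t ltac:(lra)). lra.
Qed.

(** A Cauchy-type integral with kernel (zeta - w)^(-n) over a circle. The factor d zeta is part of
    the density [h], and 1 / (2 pi i) is left out. *)
Definition ctrans (h : R -> C) (w0 : C) (r : R) (n : nat) (w : C) : C :=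
  CInt (fun t => h t * / ((circ w0 r t - w) ^ n))%C 0 (2 * PI).

Lemma Cpow_ne0 (z : C) (n : nat) : z <> RtoC 0 -> (z ^ n)%C <> RtoC 0.
Proof.
  intros H. apply Cmod_pos_ne0. rewrite Cmod_pow. apply pow_lt, Cmod_gt_0, H.
Qed.

Lemma ccont_pow {U : UniformSpace} (f : U -> C) (n : nat) (u : U) :
  ccont f u -> ccont (fun w => (f w ^ n)%C) u.
Proof.
  intros H. induction n as [|n IH]; [apply ccont_const|]. apply ccont_mult; assumption.
Qed.

Lemma ctrans_kernel_cont (h : R -> C) (w0 : C) (r : R) (n : nat) (w : C) :
  (forall t, ccont h t) -> Cmod (w - w0) < r ->
  forall t, ccont (fun t => h t * / ((circ w0 r t - w) ^ n))%C t.
Proof.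
  intros Hh Hw t. apply ccont_mult; [apply Hh|].
  apply ccont_inv; [|apply Cpow_ne0, circ_ne0, Hw].
  apply ccont_pow. apply ccont_minus; [apply circ_cont|apply ccont_const].
Qed.

(** The slope function of [f] at [w] has a primitive, so its integral over the closed circle is 0.
    The winding factor on the left is evaluated only at the centre; elsewhere it suffices that it is
    differentiable, hence nonzero near the centre. *)
Lemma cauchy_formula (f : C -> C) (w0 w : C) (r : R) : holo f -> Cmod (w - w0) < r ->
  (f w * ctrans (dcirc r) w0 r 1 w = ctrans (fun t => f (circ w0 r t) * dcirc r t) w0 r 1 w)%C.
Proof.
  intros Hf Hw. destruct (quotient_primitive f w Hf) as [q [Q [He [_ [Hq HQ]]]]].
  assert (H0 := circ_int_prim Q q w0 r Hq HQ).
  assert (Hc := dcirc_cont r).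
  assert (Hc2 : forall t, ccont (fun t => f (circ w0 r t) * dcirc r t)%C t).
  { intros t. apply ccont_mult; [apply circ_comp_cont, holo_cont, Hf|apply Hc]. }
  rewrite (CInt_ext _ (fun t => (f (circ w0 r t) * dcirc r t) * / ((circ w0 r t - w) ^ 1)
      - f w * (dcirc r t * / ((circ w0 r t - w) ^ 1)))%C) in H0.
  - rewrite CInt_minus, CInt_scal in H0.
    + fold (ctrans (fun t => f (circ w0 r t) * dcirc r t)%C w0 r 1 w) in H0.
      fold (ctrans (dcirc r) w0 r 1 w) in H0.
      symmetry.
      replace (ctrans (fun t => f (circ w0 r t) * dcirc r t)%C w0 r 1 w) with
       (ctrans (fun t => f (circ w0 r t) * dcirc r t)%C w0 r 1 w - f w * ctrans (dcirc r) w0 r 1 w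
         + f w * ctrans (dcirc r) w0 r 1 w)%C by ring.
      rewrite H0. ring.
    + apply ctrans_kernel_cont; assumption.
    + apply ctrans_kernel_cont with (h := fun t => (f (circ w0 r t) * dcirc r t)%C); assumption.
    + intros t. apply ccont_mult; [apply ccont_const|]. apply ctrans_kernel_cont; assumption.
  - intros t. rewrite (He (circ w0 r t)). field. apply circ_ne0, Hw.
Qed.

Lemma ctrans_center (w0 : C) (r : R) : 0 < r ->
  ctrans (dcirc r) w0 r 1 w0 = (RtoC (2 * PI) * Ci)%C.
Proof.
  intros Hr. unfold ctrans. rewrite (CInt_ext _ (fun _ => Ci)).
  - rewrite CInt_const, Rminus_0_r. reflexivity.
  - intros t. unfold dcirc, circ.
    assert (H1 : RtoC r <> RtoC 0) by (intros K; apply RtoC_inj in K; lra).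
    assert (H2 : expi t <> RtoC 0) by (apply Cmod_pos_ne0; rewrite expi_mod; lra).
    field. replace (w0 + RtoC r * expi t - w0)%C with (RtoC r * expi t)%C by ring.
    apply Cmult_neq_0; assumption.
Qed.

Lemma mean_value_bound (f : C -> C) (w : C) (r M : R) : holo f -> 0 < r ->
  (forall t, 0 <= t <= 2 * PI -> Cmod (f (circ w r t)) <= M) -> Cmod (f w) <= M.
Proof.
  intros Hf Hr HM. assert (Hp := PI_RGT_0).
  assert (Hw : Cmod (w - w) < r).
  { replace (w - w)%C with (RtoC 0) by ring. rewrite Cmod_0. exact Hr. }
  assert (E := cauchy_formula f w w r Hf Hw). rewrite ctrans_center in E by exact Hr.
  assert (E2 := f_equal Cmod E). rewrite !Cmod_mult, Cmod_Ci, Cmod_R, Rabs_pos_eq in E2 by lra.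
  assert (B : Cmod (ctrans (fun t => f (circ w r t) * dcirc r t)%C w r 1 w) <= Rabs (2 * PI - 0) * M).
  { apply CInt_bound.
    - apply ctrans_kernel_cont; [|exact Hw].
      intros t. apply ccont_mult; [apply circ_comp_cont, holo_cont, Hf|apply dcirc_cont].
    - rewrite Rmin_left, Rmax_right by lra. intros t Ht. replace (f (circ w r t) * dcirc r t * / (circ w r t - w) ^ 1)%C
        with (f (circ w r t) * Ci)%C.
      + rewrite Cmod_mult, Cmod_Ci, Rmult_1_r. apply HM, Ht.
      + unfold dcirc. assert (Hn := circ_ne0 w w r t Hw).
        replace (RtoC r * (Ci * expi t))%C with (Ci * (circ w r t - w))%C by (unfold circ; ring).
        field. exact Hn. }
  rewrite <- E2, Rminus_0_r, Rabs_pos_eq in B by lra. nra.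
Qed.

Lemma bounded_on_segment (h : R -> C) (a b : R) : a <= b -> (forall t, ccont h t) ->
  exists B, 0 < B /\ forall t, a <= t <= b -> Cmod (h t) <= B.
Proof.
  intros Hab Hh.
  destruct (continuity_ab_maj (fun t => Cmod (h t)) a b Hab) as [m [Hm _]].
  { intros t _. apply continuity_pt_filterlim. apply (continuous_Cmod h t (Hh t)). }
  exists (Cmod (h m) + 1). split; [assert (H := Cmod_ge_0 (h m)); lra|].
  intros t Ht. specialize (Hm t Ht). simpl in Hm. lra.
Qed.

(** Differentiation under the integral sign. Here u is the distance vector from [w] to the circle
    and k the increment of [w]; the hypothesis is a Taylor estimate for the kernel u^(-n), uniform
    along the circle, whose linear term is c u^(-m). *)
Lemma ctrans_cder (h : R -> C) (w0 w c : C) (r M : R) (n m : nat) :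
  (forall t, ccont h t) -> Cmod (w - w0) < r ->
  (forall u k, r - Cmod (w - w0) <= Cmod u -> Cmod k <= (r - Cmod (w - w0)) / 2 ->
    Cmod (/ (u - k) ^ n - / u ^ n - k * (c * / u ^ m)) <= M * (Cmod k * Cmod k)) ->
  cder (ctrans h w0 r n) w (c * ctrans h w0 r m w)%C.
Proof.
  intros Hh Hw HK. set (d := r - Cmod (w - w0)) in *.
  assert (Hd : 0 < d) by (unfold d; lra). assert (Hpi := PI_RGT_0).
  destruct (bounded_on_segment h 0 (2 * PI) ltac:(lra) Hh) as [B [HB0 HB]].
  assert (HM : 0 <= M).
  { assert (H := HK (RtoC d) (RtoC (d / 2))). rewrite !Cmod_R, !Rabs_pos_eq in H by lra.
    specialize (H ltac:(lra) ltac:(lra)). 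
    assert (H1 := Rle_trans _ _ _ (Cmod_ge_0 _) H).
    apply Rmult_le_reg_r with (d / 2 * (d / 2)); [nra|]. rewrite Rmult_0_l. exact H1. }
  apply cder_eps. intros eps He.
  set (L := 2 * PI * (B * M) + 1).
  assert (HL : 0 < L). { unfold L. assert (0 <= 2 * PI * (B * M)); [|lra].
    apply Rmult_le_pos; [lra|]. apply Rmult_le_pos; lra. }
  exists (Rmin (d / 2) (eps / L)). split.
  { apply Rmin_pos; [lra|]. apply Rdiv_lt_0_compat; assumption. }
  intros w' Hw'. set (k := (w' - w)%C) in *.
  assert (K1 : Cmod k < d / 2) by (eapply Rlt_le_trans; [exact Hw'|apply Rmin_l]).
  assert (K2 : Cmod k < eps / L) by (eapply Rlt_le_trans; [exact Hw'|apply Rmin_r]).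
  assert (K0 := Cmod_ge_0 k).
  assert (Hw2 : Cmod (w' - w0) < r).
  { replace (w' - w0)%C with (k + (w - w0))%C by (unfold k; ring).
    eapply Rle_lt_trans; [apply Cmod_triangle|]. unfold d in *. lra. }
  assert (C1 := ctrans_kernel_cont h w0 r n w Hh Hw).
  assert (C2 := ctrans_kernel_cont h w0 r n w' Hh Hw2).
  assert (C3 := ctrans_kernel_cont h w0 r m w Hh Hw).
  unfold ctrans.
  set (F1 := fun t => (h t * / (circ w0 r t - w) ^ n)%C) in *.
  set (F2 := fun t => (h t * / (circ w0 r t - w') ^ n)%C) in *.
  set (F3 := fun t => (h t * / (circ w0 r t - w) ^ m)%C) in *.
  replace (CInt F2 0 (2 * PI) - CInt F1 0 (2 * PI) - c * CInt F3 0 (2 * PI) * k)%C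
    with (CInt F2 0 (2 * PI) - CInt F1 0 (2 * PI) - (k * c) * CInt F3 0 (2 * PI))%C by ring.
  assert (C4 : forall t, ccont (fun t => k * c * F3 t)%C t).
  { intros t. apply ccont_mult; [apply ccont_const|apply C3]. }
  assert (C5 : forall t, ccont (fun t => F2 t - F1 t)%C t).
  { intros t. apply ccont_minus; [apply C2|apply C1]. }
  rewrite <- CInt_scal, <- CInt_minus, <- CInt_minus by assumption.
  assert (B1 : Cmod (CInt (fun t => F2 t - F1 t - k * c * F3 t)%C 0 (2 * PI)) <=
    Rabs (2 * PI - 0) * (B * (M * (Cmod k * Cmod k)))).
  { apply CInt_bound.
    - intros t. apply ccont_minus; [apply C5|apply C4].
    - rewrite Rmin_left, Rmax_right by lra. intros t Ht. unfold F1, F2, F3.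
      set (u := (circ w0 r t - w)%C).
      replace (circ w0 r t - w')%C with (u - k)%C by (unfold u, k; ring).
      replace (h t * / (u - k) ^ n - h t * / u ^ n - k * c * (h t * / u ^ m))%C
        with (h t * (/ (u - k) ^ n - / u ^ n - k * (c * / u ^ m)))%C by ring.
      rewrite Cmod_mult. apply Rmult_le_compat; try apply Cmod_ge_0; [apply HB, Ht|].
      apply HK; [|lra]. unfold u, d. apply circ_dist. assert (H := Cmod_ge_0 (w - w0)). lra. }
  eapply Rle_trans; [exact B1|]. rewrite Rminus_0_r, Rabs_pos_eq by lra.
  assert (K3 : L * Cmod k <= eps).
  { replace eps with (L * (eps / L)) by (field; lra). apply Rmult_le_compat_l; lra. }
  unfold L in K3.
  replace (2 * PI * (B * (M * (Cmod k * Cmod k)))) with (2 * PI * (B * M) * Cmod k * Cmod k) by ring.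
  apply Rmult_le_compat_r; [exact K0|]. nra.
Qed.

Lemma Cmod_sub_lower (u k : C) (d : R) : d <= Cmod u -> Cmod k <= d / 2 -> d / 2 <= Cmod (u - k).
Proof.
  intros Hu Hk. assert (H := Cmod_triangle (u - k) k).
  replace (u - k + k)%C with u in H by ring. lra.
Qed.

Lemma kernel_bound_1 (u k : C) (d : R) : 0 < d -> d <= Cmod u -> Cmod k <= d / 2 ->
  Cmod (/ (u - k) ^ 1 - / u ^ 1 - k * (RtoC 1 * / u ^ 2)) <= / (d * d * (d / 2)) * (Cmod k * Cmod k).
Proof.
  intros Hd Hu Hk. assert (Hl := Cmod_sub_lower u k d Hu Hk).
  assert (N1 : u <> RtoC 0) by (apply Cmod_pos_ne0; lra).
  assert (N2 : (u - k)%C <> RtoC 0) by (apply Cmod_pos_ne0; lra).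
  replace (/ (u - k) ^ 1 - / u ^ 1 - k * (RtoC 1 * / u ^ 2))%C
    with (/ (u * u * (u - k)) * (k * k))%C by (field; split; assumption).
  rewrite Cmod_mult, Cmod_inv, !Cmod_mult by (repeat apply Cmult_neq_0; assumption).
  apply Rmult_le_compat_r; [assert (H := Cmod_ge_0 k); nra|].
  apply Rinv_le_contravar; [repeat apply Rmult_lt_0_compat; lra|]. apply Rmult_le_compat; nra.
Qed.

(** The remainder is k^2 (3 - 2 k / u) / (u^2 (u - k)^2). Since |k / u| <= 1/2, the bracket has
    modulus at most 4. *)
Lemma kernel_bound_2 (u k : C) (d : R) : 0 < d -> d <= Cmod u -> Cmod k <= d / 2 ->
  Cmod (/ (u - k) ^ 2 - / u ^ 2 - k * (RtoC 2 * / u ^ 3))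
    <= (4 * / (d * d * (d / 2 * (d / 2)))) * (Cmod k * Cmod k).
Proof.
  intros Hd Hu Hk. assert (Hl := Cmod_sub_lower u k d Hu Hk).
  assert (N1 : u <> RtoC 0) by (apply Cmod_pos_ne0; lra).
  assert (N2 : (u - k)%C <> RtoC 0) by (apply Cmod_pos_ne0; lra).
  replace (/ (u - k) ^ 2 - / u ^ 2 - k * (RtoC 2 * / u ^ 3))%C
    with (((RtoC 3 - RtoC 2 * (k * / u)) * / (u * u * ((u - k) * (u - k)))) * (k * k))%C
    by (field; split; assumption).
  rewrite !Cmod_mult, Cmod_inv, !Cmod_mult by (repeat apply Cmult_neq_0; assumption).
  apply Rmult_le_compat_r; [assert (H := Cmod_ge_0 k); nra|].
  apply Rmult_le_compat.
  - apply Cmod_ge_0.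
  - left. apply Rinv_0_lt_compat. repeat apply Rmult_lt_0_compat; lra.
  - unfold Cminus. eapply Rle_trans; [apply Cmod_triangle|].
    rewrite Cmod_opp, !Cmod_mult, Cmod_inv, !Cmod_R, !Rabs_pos_eq by (assumption || lra).
    assert (Cmod k * / Cmod u <= / 2); [|lra].
    apply Rmult_le_reg_r with (Cmod u); [lra|]. rewrite Rmult_assoc, Rinv_l by lra. lra.
  - apply Rinv_le_contravar; [repeat apply Rmult_lt_0_compat; lra|].
    assert (0 <= d * d) by (apply Rmult_le_pos; lra).
    assert (0 <= d / 2 * (d / 2)) by (apply Rmult_le_pos; lra).
    apply Rmult_le_compat; [assumption|assumption| |]; apply Rmult_le_compat; lra.
Qed.

Lemma ctrans_cder_1 (h : R -> C) (w0 w : C) (r : R) : (forall t, ccont h t) -> Cmod (w - w0) < r ->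
  cder (ctrans h w0 r 1) w (RtoC 1 * ctrans h w0 r 2 w)%C.
Proof.
  intros Hh Hw. eapply ctrans_cder; [exact Hh|exact Hw|].
  intros u k Hu Hk. apply kernel_bound_1 with (d := r - Cmod (w - w0)); [lra|exact Hu|exact Hk].
Qed.

Lemma ctrans_cder_2 (h : R -> C) (w0 w : C) (r : R) : (forall t, ccont h t) -> Cmod (w - w0) < r ->
  cder (ctrans h w0 r 2) w (RtoC 2 * ctrans h w0 r 3 w)%C.
Proof.
  intros Hh Hw. eapply ctrans_cder; [exact Hh|exact Hw|].
  intros u k Hu Hk. apply kernel_bound_2 with (d := r - Cmod (w - w0)); [lra|exact Hu|exact Hk].
Qed.

(** * Derivatives of entire functions and orders of zeros *)

(** Near [w0] Cauchy's formula gives f = I / N with two Cauchy-type integrals, where N does not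
    vanish. The quotient rule expresses f' through the kernels of orders 1 and 2, and these can be
    differentiated once more. *)
Lemma holo_derivative (f : C -> C) : holo f ->
  exists f1, (forall z, cder f z (f1 z)) /\ holo f1.
Proof.
  intros Hf. destruct (choice (fun z l => cder f z l) Hf) as [f1 H1].
  exists f1. split; [exact H1|]. intros w0.
  assert (Hd : forall t, ccont (dcirc 1) t) by apply dcirc_cont.
  assert (Hfd : forall t, ccont (fun t => f (circ w0 1 t) * dcirc 1 t)%C t).
  { intros t. apply ccont_mult; [apply circ_comp_cont, holo_cont, Hf|apply dcirc_cont]. }
  set (N := ctrans (dcirc 1) w0 1). set (I := ctrans (fun t => f (circ w0 1 t) * dcirc 1 t)%C w0 1).
  assert (Hw0 : Cmod (w0 - w0) < 1).
  { replace (w0 - w0)%C with (RtoC 0) by ring. rewrite Cmod_0. lra. }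
  assert (N0 : N 1%nat w0 <> RtoC 0).
  { unfold N. rewrite ctrans_center by lra. apply Cmod_pos_ne0.
    assert (Hp := PI_RGT_0). rewrite Cmod_mult, Cmod_R, Cmod_Ci, Rabs_pos_eq; lra. }
  assert (DN : forall w, Cmod (w - w0) < 1 -> cder (N 1%nat) w (RtoC 1 * N 2%nat w)%C)
    by (intros; apply ctrans_cder_1; assumption).
  assert (DI : forall w, Cmod (w - w0) < 1 -> cder (I 1%nat) w (RtoC 1 * I 2%nat w)%C)
    by (intros; apply ctrans_cder_1; assumption).
  assert (DN2 := ctrans_cder_2 _ w0 w0 1 Hd Hw0). assert (DI2 := ctrans_cder_2 _ w0 w0 1 Hfd Hw0).
  change (cder (N 2%nat) w0 (RtoC 2 * N 3%nat w0)%C) in DN2.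
  change (cder (I 2%nat) w0 (RtoC 2 * I 3%nat w0)%C) in DI2.
  assert (Hloc : @locally C_UniformSpace w0 (fun w => Cmod (w - w0) < 1 /\ N 1%nat w <> RtoC 0)).
  { apply filter_and.
    - apply locally_Cmod. exists 1. split; [lra|]. auto.
    - generalize (ccont_ne0 _ _ (cder_cont _ _ _ (DN w0 Hw0)) N0). apply filter_imp.
      intros w Hw. apply Cmod_pos_ne0. assert (Hp := proj1 (Cmod_gt_0 _) N0). lra. }
  destruct (proj1 (locally_Cmod _ _) Hloc) as [d [Hdp Hdd]].
  eexists.
  apply cder_ext_loc with (fun w => (RtoC 1 * I 2%nat w) * / N 1%nat w
     + I 1%nat w * (- (RtoC 1 * N 2%nat w) * / (N 1%nat w * N 1%nat w)))%C.
  - apply locally_Cmod. exists d. split; [exact Hdp|]. intros w Hw.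
    destruct (Hdd w Hw) as [Hw1 Hw2].
    apply cder_unique with f w; [|apply H1].
    apply cder_ext_loc with (fun w => I 1%nat w * / N 1%nat w)%C.
    + apply locally_Cmod. exists (d - Cmod (w - w0)). split; [lra|]. intros v Hv.
      assert (Hv' : Cmod (v - w0) < d).
      { replace (v - w0)%C with (v - w + (w - w0))%C by ring.
        eapply Rle_lt_trans; [apply Cmod_triangle|]. lra. }
      destruct (Hdd v Hv') as [Hv1 Hv2].
      assert (EC := cauchy_formula f w0 v 1 Hf Hv1). change (f v * N 1%nat v = I 1%nat v)%C in EC.
      rewrite <- EC. field. exact Hv2.
    + exact (cder_mult _ _ _ _ _ (DI w Hw1) (cder_inv _ _ _ (DN w Hw1) Hw2)).
  - apply cder_plus.
    + apply cder_mult; [apply cder_mult; [apply cder_const|exact DI2]|].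
      apply cder_inv; [apply DN, Hw0|exact N0].
    + apply cder_mult; [apply DI, Hw0|]. apply cder_mult.
      * apply cder_opp. apply cder_mult; [apply cder_const|exact DN2].
      * apply cder_inv; [|apply Cmult_neq_0; exact N0].
        apply cder_mult; apply DN, Hw0.
Qed.

(** The slope function is the derivative of the entire function Q, hence itself entire, also at
    [w]. *)
Lemma holo_factor (f : C -> C) (w : C) : holo f ->
  exists q, holo q /\ cder f w (q w) /\ forall z, f z = (f w + q z * (z - w))%C.
Proof.
  intros Hf. destruct (quotient_primitive f w Hf) as [q [Q [He [Hl [Hq HQ]]]]].
  exists q. split; [|split; assumption].
  assert (HQh : holo Q) by (intros z; exists (q z); apply HQ).
  destruct (holo_derivative Q HQh) as [Q1 [HQ1 HQ2]].
  intros z. destruct (HQ2 z) as [l Hlz]. exists l.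
  apply cder_ext with Q1; [|exact Hlz]. intros v. exact (cder_unique Q v _ _ (HQ1 v) (HQ v)).
Qed.

(** Replaces power series and the identity theorem: if (z - z0)^n could be split off for every n,
    bounding the cofactor at [w] by its values on a large circle would force f(w) = 0. *)
Lemma holo_order (f : C -> C) (z0 : C) : holo f -> ~ (forall z, f z = RtoC 0) ->
  exists m g, holo g /\ g z0 <> RtoC 0 /\ forall z, f z = ((z - z0) ^ m * g z)%C.
Proof.
  intros Hf Hn. apply NNPP. intros Hno.
  assert (H : forall n, exists g, holo g /\ forall z, f z = ((z - z0) ^ n * g z)%C).
  { induction n as [|n [g [Hg He]]].
    - exists f. split; [exact Hf|]. intros z. simpl. ring.
    - destruct (Ceq_dec (g z0) (RtoC 0)) as [E|E].
      + destruct (holo_factor g z0 Hg) as [q [Hq [_ Hgq]]]. exists q. split; [exact Hq|].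
        intros z. rewrite He, Hgq, E. simpl. ring.
      + contradict Hno. exists n, g. split; [exact Hg|]. split; assumption. }
  apply Hn. intros w. set (a := Cmod (w - z0)).
  assert (Ha : 0 <= a) by apply Cmod_ge_0.
  (* On the circle of radius 3 a + 2 about w one has |z - z0| >= b = 2 a + 2, while |w - z0| = a.
     Hence |f(w)| <= M (a / b)^n <= M / 2^n. *)
  set (r := 3 * a + 2). assert (Hr : 0 < r) by (unfold r; lra).
  assert (Hp := PI_RGT_0).
  destruct (bounded_on_segment (fun t => f (circ w r t)) 0 (2 * PI) ltac:(lra)) as [M [HM0 HM]].
  { intros t. apply circ_comp_cont, holo_cont, Hf. }
  apply NNPP. intros Hfw. apply Cmod_gt_0 in Hfw.
  destruct (half_pow_small M (Cmod (f w)) Hfw) as [n Hsmall].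
  destruct (H n) as [g [Hg He]].
  set (b := 2 * a + 2). assert (Hb : 0 < b ^ n) by (apply pow_lt; unfold b; lra).
  assert (Hgb : Cmod (g w) <= M / b ^ n).
  { apply mean_value_bound with r; [exact Hg|exact Hr|]. intros t Ht.
    assert (Hz : b <= Cmod (circ w r t - z0)).
    { assert (D := proj1 (circ_dist w z0 r t ltac:(lra))).
      replace (z0 - w)%C with (- (w - z0))%C in D by ring. rewrite Cmod_opp in D.
      fold a in D. unfold b, r in *. lra. }
    specialize (HM t Ht). rewrite He, Cmod_mult, Cmod_pow in HM.
    assert (Hpow : b ^ n <= Cmod (circ w r t - z0) ^ n) by (apply pow_incr; unfold b in *; lra).
    apply Rmult_le_reg_r with (b ^ n); [exact Hb|].
    unfold Rdiv. rewrite Rmult_assoc, Rinv_l, Rmult_1_r by lra.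
    eapply Rle_trans; [|exact HM]. rewrite Rmult_comm.
    apply Rmult_le_compat_r; [apply Cmod_ge_0|exact Hpow]. }
  assert (E := f_equal Cmod (He w)). rewrite Cmod_mult, Cmod_pow in E. fold a in E.
  assert (H2n : 0 < 2 ^ n) by (apply pow_lt; lra).
  assert (Hab : a ^ n * 2 ^ n <= b ^ n).
  { rewrite <- Rpow_mult_distr. apply pow_incr. unfold b. lra. }
  assert (HF : Cmod (f w) <= M / 2 ^ n).
  { rewrite E. apply Rle_trans with (a ^ n * (M / b ^ n)).
    - apply Rmult_le_compat_l; [apply pow_le, Ha|exact Hgb].
    - apply Rmult_le_reg_r with (2 ^ n * b ^ n); [apply Rmult_lt_0_compat; lra|].
      replace (a ^ n * (M / b ^ n) * (2 ^ n * b ^ n)) with (M * (a ^ n * 2 ^ n)) by (field; lra).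
      replace (M / 2 ^ n * (2 ^ n * b ^ n)) with (M * b ^ n) by (field; lra).
      apply Rmult_le_compat_l; lra. }
  lra.
Qed.

Lemma holo_isolated (f : C -> C) (z0 : C) : holo f -> ~ (forall z, f z = RtoC 0) ->
  exists d, 0 < d /\ forall z, Cmod (z - z0) < d -> z <> z0 -> f z <> RtoC 0.
Proof.
  intros Hf Hn. destruct (holo_order f z0 Hf Hn) as [m [g [Hg [Hg0 He]]]].
  destruct (proj1 (locally_Cmod _ _) (ccont_ne0 g z0 (holo_cont g Hg z0) Hg0)) as [d [Hd Hdd]].
  exists d. split; [exact Hd|]. intros z Hz Hne. rewrite He.
  apply Cmult_neq_0; [apply Cpow_ne0, Csub_ne0, Hne|].
  specialize (Hdd z Hz). apply Cmod_pos_ne0. apply Cmod_gt_0 in Hg0. lra.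
Qed.

(** * Second-order calculus along lines *)

Definition jet2 (A : R -> R) (a1 a2 : R) : Prop :=
  exists A' : R -> R, locally 0 (fun s => is_derive A s (A' s)) /\ A' 0 = a1 /\ is_derive A' 0 a2.

Lemma jet2_plus (A B : R -> R) (a1 a2 b1 b2 : R) :
  jet2 A a1 a2 -> jet2 B b1 b2 -> jet2 (fun s => A s + B s) (a1 + b1) (a2 + b2).
Proof.
  intros [A' [HA [HA0 HA2]]] [B' [HB [HB0 HB2]]]. exists (fun s => A' s + B' s).
  split; [|split; [rewrite HA0, HB0; reflexivity|apply (is_derive_plus (V:=R_NormedModule)); assumption]].
  generalize (filter_and _ _ HA HB). apply filter_imp. intros s [H1 H2].
  apply (is_derive_plus (V:=R_NormedModule)); assumption.
Qed.

Lemma jet2_scal (k : R) (A : R -> R) (a1 a2 : R) :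
  jet2 A a1 a2 -> jet2 (fun s => k * A s) (k * a1) (k * a2).
Proof.
  intros [A' [HA [HA0 HA2]]]. exists (fun s => k * A' s).
  split; [|split; [rewrite HA0; reflexivity|apply is_derive_scal; assumption]].
  revert HA. apply filter_imp. intros s H1. apply is_derive_scal; assumption.
Qed.

Lemma jet2_comp (g g1 : R -> R) (g2 : R) (A : R -> R) (a1 a2 : R) :
  locally (A 0) (fun L => is_derive g L (g1 L)) -> is_derive g1 (A 0) g2 -> jet2 A a1 a2 ->
  jet2 (fun s => g (A s)) (g1 (A 0) * a1) (g2 * (a1 * a1) + g1 (A 0) * a2).
Proof.
  intros Hg Hg2 [A' [HA [HA0 HA2]]]. exists (fun s => g1 (A s) * A' s).
  assert (D0 : is_derive A 0 (A' 0)) by (apply locally_singleton in HA; exact HA).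
  split; [|split; [rewrite HA0; reflexivity|]].
  - assert (C0 : continuous A 0) by (apply (ex_derive_continuous (V:=R_NormedModule)); exists (A' 0); exact D0).
    generalize (filter_and _ _ HA (C0 _ Hg)). apply filter_imp. intros s [H1 H2].
    rewrite Rmult_comm. apply (is_derive_comp (V:=R_NormedModule) g A s _ _ H2 H1).
  - rewrite <- HA0 at 1 2. rewrite HA0 at 2.
    assert (D1 := is_derive_comp (V:=R_NormedModule) g1 A 0 _ _ Hg2 D0).
    replace (g2 * (A' 0 * a1) + g1 (A 0) * a2) with ((A' 0 * g2) * A' 0 + g1 (A 0) * a2)
      by (rewrite HA0; ring).
    apply (is_derive_mult (K:=R_AbsRing) _ _ 0 _ _ D1 HA2). intros; apply Rmult_comm.
Qed.

(** If a2 > 0, then A' > 0 just to the right of 0 in case a1 >= 0, and A' < 0 just to the left in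
    case a1 < 0. On that side the mean value theorem produces values above A(0). *)
Lemma jet2_max (A : R -> R) (a1 a2 : R) :
  jet2 A a1 a2 -> locally 0 (fun s => A s <= A 0) -> a2 <= 0.
Proof.
  intros [A' [HA [HA0 HA2]]] Hmax. apply Rnot_lt_le. intros Ha2.
  destruct HA2 as [_ HA2]. assert (H0 : is_filter_lim (locally 0) 0) by (intros P HP; exact HP).
  specialize (HA2 0 H0 (mkposreal (a2 / 2) ltac:(lra))).
  destruct (filter_and _ _ (filter_and _ _ HA Hmax) HA2) as [d Hd].
  assert (Hloc : forall s, Rabs s < d -> is_derive A s (A' s) /\ A s <= A 0 /\
    Rabs (A' s - a1 - s * a2) <= a2 / 2 * Rabs s).
  { intros s Hs. destruct (Hd s) as [[H1 H2] H3].
    { change (Rabs (s - 0) < d). rewrite Rminus_0_r. exact Hs. }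
    change (Rabs (A' s - A' 0 - (s - 0) * a2) <= a2 / 2 * Rabs (s - 0)) in H3.
    rewrite HA0, Rminus_0_r in H3. auto. }
  assert (Hdp := cond_pos d).
  destruct (Rle_lt_dec 0 a1) as [Ha1|Ha1].
  - destruct (MVT_cor2 A A' 0 (d / 2)) as [c [E Hc]]; [lra| |].
    { intros s Hs. apply is_derive_Reals, Hloc. rewrite Rabs_pos_eq; lra. }
    destruct (Hloc (d / 2)) as [_ [H1 _]]; [rewrite Rabs_pos_eq; lra|].
    destruct (Hloc c) as [_ [_ H2]]; [rewrite Rabs_pos_eq; lra|].
    rewrite (Rabs_pos_eq c) in H2 by lra. apply Rabs_le_between in H2.
    assert (P1 : 0 < c * a2) by (apply Rmult_lt_0_compat; lra).
    assert (P2 : 0 < A' c * (d / 2 - 0)) by (apply Rmult_lt_0_compat; lra). lra.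
  - destruct (MVT_cor2 A A' (- (d / 2)) 0) as [c [E Hc]]; [lra| |].
    { intros s Hs. apply is_derive_Reals, Hloc. rewrite Rabs_left1; lra. }
    destruct (Hloc (- (d / 2))) as [_ [H1 _]]; [rewrite Rabs_left1; lra|].
    destruct (Hloc c) as [_ [_ H2]]; [rewrite Rabs_left1; lra|].
    rewrite (Rabs_left1 c) in H2 by lra. apply Rabs_le_between in H2.
    assert (P1 : 0 < (- c) * a2) by (apply Rmult_lt_0_compat; lra).
    assert (P2 : 0 < (- A' c) * (0 - - (d / 2))) by (apply Rmult_lt_0_compat; lra). lra.
Qed.

Lemma is_derive_ln_Cmod (g : R -> C) (t : R) (l : C) : rder g t l -> g t <> RtoC 0 ->
  is_derive (fun s => ln (Cmod (g s))) t (Re (l / g t)).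
Proof.
  intros Hg Hn.
  assert (HR := rder_Re g t l Hg).
  assert (HI : is_derive (fun s => Im (g s)) t (Im l)).
  { assert (Hm : rder (fun s => - Ci * g s)%C t (- Ci * l)%C).
    { destruct Hg as [p [Hp [Hl He]]]. exists (fun s => - Ci * p s)%C.
      split; [apply ccont_mult; [apply ccont_const|exact Hp]|]. split; [rewrite Hl; reflexivity|].
      intros s. rewrite (He s). ring. }
    apply rder_Re in Hm. replace (Im l) with (Re (- Ci * l)%C) by (unfold Re, Im; simpl; ring).
    apply is_derive_ext with (2 := Hm). intros s. unfold Re, Im; simpl; ring. }
  assert (Hpos : 0 < Re (g t) * Re (g t) + Im (g t) * Im (g t)).
  { apply Cmod_gt_0 in Hn. assert (E := Cmod2_alt (g t)). simpl in E. rewrite !Rmult_1_r in E.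
    rewrite <- E. apply Rmult_lt_0_compat; exact Hn. }
  apply is_derive_ext with (fun s => ln (sqrt (Re (g s) * Re (g s) + Im (g s) * Im (g s)))).
  { intros s. unfold Cmod, Re, Im. simpl. rewrite !Rmult_1_r. reflexivity. }
  set (a := fun s => Re (g s)) in *. set (b := fun s => Im (g s)) in *.
  change (is_derive (fun s => ln (sqrt (a s * a s + b s * b s))) t (Re (l / g t))).
  assert (Hpos' : 0 < a t * a t + b t * b t) by exact Hpos.
  auto_derive.
  - repeat split; try (eexists; eassumption); [exact Hpos'|apply sqrt_lt_R0, Hpos'].
  - change (Derive (fun x : R => a x) t) with (Derive a t).
    change (Derive (fun x : R => b x) t) with (Derive b t).
    rewrite (is_derive_unique a _ _ HR), (is_derive_unique b _ _ HI).
    assert (S0 := sqrt_lt_R0 _ Hpos').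
    assert (S2 := sqrt_sqrt (a t * a t + b t * b t) ltac:(lra)).
    assert (E : Re (l / g t) = (Re l * a t + Im l * b t) / (a t * a t + b t * b t)).
    { unfold a, b, Cdiv, Cinv, Cmult, Re, Im; simpl. field.
      unfold a, b, Re, Im in Hpos'. lra. }
    rewrite E. set (r := sqrt (a t * a t + b t * b t)) in *.
    rewrite <- S2. field. lra.
Qed.

(** Harmonicity of log |g| in directional form: k = (g'/g)' is the same for all directions, so the
    contributions of th = 1 and th = i cancel, their squares being 1 and -1. *)
Lemma jet2_ln_Cmod (g g1 g2 : C -> C) (z : C) :
  (forall w, cder g w (g1 w)) -> (forall w, cder g1 w (g2 w)) -> g z <> RtoC 0 ->
  exists k, forall th, jet2 (fun s => ln (Cmod (g (z + RtoC s * th)%C)))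
    (Re (th * (g1 z / g z))) (Re (th * th * k)).
Proof.
  intros H1 H2 Hn.
  exists (g2 z * / g z + g1 z * (- g1 z / (g z * g z)))%C. intros th.
  set (line := fun s : R => (z + RtoC s * th)%C).
  assert (L0 : line 0 = z) by (unfold line; ring).
  exists (fun s => Re (th * (g1 (line s) / g (line s)))%C).
  split; [|split].
  - assert (C0 : ccont (fun s => g (line s)) 0).
    { apply (ccont_comp (V:=C_UniformSpace) line g); [|apply (cder_cont_all g g1 H1)].
      exact (rder_cont _ _ _ (rder_line z th 0)). }
    assert (Hn0 : g (line 0) <> RtoC 0) by (rewrite L0; exact Hn).
    generalize (ccont_ne0 _ _ C0 Hn0). apply filter_imp. intros s Hs.
    assert (Hns : g (line s) <> RtoC 0).
    { apply Cmod_pos_ne0. apply Cmod_gt_0 in Hn0. simpl in Hs. lra. }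
    replace (th * (g1 (line s) / g (line s)))%C with (g1 (line s) * th / g (line s))%C
      by (field; exact Hns).
    apply (is_derive_ln_Cmod (fun s => g (line s)) s _); [|exact Hns].
    apply rder_comp; [apply rder_line|apply H1].
  - rewrite L0. reflexivity.
  - apply rder_Re.
    set (q := fun w => (th * (g1 w * / g w))%C).
    replace (th * th * (g2 z * / g z + g1 z * (- g1 z / (g z * g z))))%C
      with ((0 * (g1 z * / g z) + th * (g2 z * / g z + g1 z * (- g1 z / (g z * g z)))) * th)%C by ring.
    apply (rder_comp q line); [apply rder_line|]. rewrite L0.
    exact (cder_mult (fun _ => th) (fun w => g1 w * / g w)%C z _ _ (cder_const _ _)
      (cder_mult g1 (fun w => / g w)%C z _ _ (H2 z) (cder_inv g z _ (H1 z) Hn))).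
Qed.

(** * The factor P, the potential log L, and their second derivatives *)

(** For L = log x this is the overview's P(x). In the variable L it is twice a hyperbolic cosine, so
    its logarithm [phi] is convex. *)
Definition cosh2 (L : R) : R := exp (L / 100) + exp (- (L / 100)).
Definition phi (L : R) : R := ln (cosh2 L).

Lemma cosh2_ge2 (L : R) : 2 <= cosh2 L.
Proof.
  unfold cosh2. rewrite exp_Ropp. assert (H := exp_pos (L / 100)). set (e := exp (L / 100)) in *.
  apply Rmult_le_reg_r with e; [exact H|]. rewrite Rmult_plus_distr_r, Rinv_l by lra.
  assert (H2 := Rle_0_sqr (e - 1)). unfold Rsqr in H2. lra.
Qed.

Lemma phi_der (L : R) :
  is_derive phi L ((exp (L / 100) - exp (- (L / 100))) / 100 / cosh2 L).
Proof.
  unfold phi, cosh2. assert (H := cosh2_ge2 L). unfold cosh2 in H.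
  auto_derive; [lra|]. change (L * / 100) with (L / 100). field. lra.
Qed.

(** With a and b the two exponentials, the numerator is (a + b)^2 - (a - b)^2 = 4 a b = 4. Its
    positivity is the only source of curvature in the whole argument. *)
Lemma phi_der2 (L : R) :
  is_derive (fun L => (exp (L / 100) - exp (- (L / 100))) / 100 / cosh2 L) L
    (4 / 10000 / (cosh2 L * cosh2 L)).
Proof.
  unfold cosh2. assert (H := cosh2_ge2 L). unfold cosh2 in H.
  auto_derive; [lra|]. change (L * / 100) with (L / 100).
  assert (E : exp (L / 100) * exp (- (L / 100)) = 1) by (rewrite <- exp_plus, Rplus_opp_r; apply exp_0).
  set (a := exp (L / 100)) in *. set (b := exp (- (L / 100))) in *.
  replace (4 / 10000) with (4 * (a * b) / 10000) by (rewrite E; field).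
  field. lra.
Qed.

(** The chain rule gives phi'' times the squared slope, plus phi' times the harmonic term. The
    latter is again of the form Re(th^2 k), because phi' is real, so only the square survives the
    sum over the two directions. *)
Lemma jet2_phi_ln_Cmod (g g1 g2 : C -> C) (z : C) :
  (forall w, cder g w (g1 w)) -> (forall w, cder g1 w (g2 w)) -> g z <> RtoC 0 ->
  exists k, forall th, exists a1, jet2 (fun s => phi (ln (Cmod (g (z + RtoC s * th)%C)))) a1
    (4 / 10000 / (cosh2 (ln (Cmod (g z))) * cosh2 (ln (Cmod (g z)))) * (Re (th * (g1 z / g z)))^2
      + Re (th * th * k)).
Proof.
  intros H1 H2 Hn. destruct (jet2_ln_Cmod g g1 g2 z H1 H2 Hn) as [k Hk].
  set (d1 := fun L => (exp (L / 100) - exp (- (L / 100))) / 100 / cosh2 L).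
  exists (RtoC (d1 (ln (Cmod (g z)))) * k)%C. intros th. eexists.
  assert (H := Hk th).
  assert (E0 : ln (Cmod (g (z + RtoC 0 * th)%C)) = ln (Cmod (g z))) by (do 3 f_equal; ring).
  assert (HJ := jet2_comp phi d1 (4 / 10000 / (cosh2 (ln (Cmod (g z))) * cosh2 (ln (Cmod (g z)))))
    (fun s => ln (Cmod (g (z + RtoC s * th)%C))) _ _ ltac:(apply filter_forall, phi_der)
    ltac:(cbv beta; rewrite E0; apply phi_der2) H).
  cbv beta in HJ. rewrite E0 in HJ.
  match type of HJ with jet2 _ _ ?x => match goal with |- jet2 _ _ ?y => replace y with x; [exact HJ|] end end.
  replace (Re (th * th * (RtoC (d1 (ln (Cmod (g z)))) * k))%C) with
    (d1 (ln (Cmod (g z))) * Re (th * th * k)%C); [ring|].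
  replace (th * th * (RtoC (d1 (ln (Cmod (g z)))) * k))%C with
    (RtoC (d1 (ln (Cmod (g z)))) * (th * th * k))%C by ring.
  set (y := (th * th * k)%C). simpl. ring.
Qed.

Definition rho (z0 : C) (R0 : R) (z : C) : R := R0 ^ 2 - Cmod (z - z0) ^ 2.

Lemma jet2_ln_rho (z0 z th : C) (R0 : R) : 0 < rho z0 R0 z ->
  let a := -2 * (Re (z - z0) * Re th + Im (z - z0) * Im th) in
  let b := -2 * (Re th ^ 2 + Im th ^ 2) in
  exists a1, jet2 (fun s => ln (rho z0 R0 (z + RtoC s * th)%C)) a1
    (- / (rho z0 R0 z) ^ 2 * (a * a) + / rho z0 R0 z * b).
Proof.
  intros Hp a b. eexists.
  set (A := fun s : R => rho z0 R0 (z + RtoC s * th)%C).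
  assert (A0 : A 0 = rho z0 R0 z) by (unfold A; f_equal; ring).
  rewrite <- A0. apply (jet2_comp ln (fun L => / L) _ A a b).
  - rewrite A0. apply (filter_imp (fun L => 0 < L)).
    + intros L HL. auto_derive; [exact HL|ring].
    + exact (open_gt 0 _ Hp).
  - rewrite A0. auto_derive; [lra|]. field. lra.
  - set (c1 := Re (z - z0)) in *. set (c2 := Im (z - z0)) in *.
    assert (E : forall s, A s = R0 ^ 2 - ((c1 + s * Re th) ^ 2 + (c2 + s * Im th) ^ 2)).
    { intros s. unfold A, rho. rewrite Cmod2_alt. unfold c1, c2, Re, Im. simpl. ring. }
    exists (fun s => - (2 * (c1 + s * Re th) * Re th + 2 * (c2 + s * Im th) * Im th)).
    split; [|split].
    + apply filter_forall. intros s.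
      apply is_derive_ext with (fun s => R0 ^ 2 - ((c1 + s * Re th) ^ 2 + (c2 + s * Im th) ^ 2));
        [intros; symmetry; apply E|]. auto_derive; [trivial|ring].
    + unfold a. ring.
    + auto_derive; [trivial|]. unfold b. ring.
Qed.

(** log L, meaningful at the points that are [generic], where none of the logarithms is singular. *)
Definition potential (f f1 : C -> C) (z : C) : R :=
  17 * ln (Cmod (f1 z)) + 12 * ln (Cmod (f1 z - f z)) + -19 * ln (Cmod (f z))
  + -11 * ln (Cmod (f z - 1)) + phi (ln (Cmod (f z))) + phi (ln (Cmod (f z - 1))).

Definition generic (f f1 : C -> C) (z : C) : Prop :=
  f1 z <> RtoC 0 /\ (f1 z - f z)%C <> RtoC 0 /\ f z <> RtoC 0 /\ (f z - 1)%C <> RtoC 0.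

Lemma Re_sqr_sum (w : C) : Re (1 * w) ^ 2 + Re (Ci * w) ^ 2 = Cmod w ^ 2.
Proof. rewrite Cmod2_alt. unfold Re, Im; simpl. ring. Qed.

Lemma Re_sum (k : C) : Re (1 * 1 * k) + Re (Ci * Ci * k) = 0.
Proof. unfold Re; simpl. ring. Qed.

(** Adding the second derivative tests for th = 1 and th = i leaves the two curvature terms of
    [phi], with factor 4/10000 = 1/2500, and 29 times the Laplacian of log rho, which is -4 R0^2 /
    rho^2. Hence 116 = 29 * 4 and 290000 = 2500 * 116. *)
Lemma laplacian_at_max (f f1 f2 f3 : C -> C) (z0 z : C) (R0 : R) :
  (forall w, cder f w (f1 w)) -> (forall w, cder f1 w (f2 w)) -> (forall w, cder f2 w (f3 w)) ->
  generic f f1 z -> 0 < rho z0 R0 z ->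
  @locally C_UniformSpace z (fun w => potential f f1 w + 29 * ln (rho z0 R0 w)
    <= potential f f1 z + 29 * ln (rho z0 R0 z)) ->
  (Cmod (f1 z) / (Cmod (f z) * cosh2 (ln (Cmod (f z))))) ^ 2
  + (Cmod (f1 z) / (Cmod (f z - 1) * cosh2 (ln (Cmod (f z - 1))))) ^ 2
    <= 290000 * R0 ^ 2 / rho z0 R0 z ^ 2.
Proof.
  intros H1 H2 H3 [G1 [G2 [G3 G4]]] Hr Hmax.
  assert (K1 : forall w, cder (fun w => f1 w - f w)%C w (f2 w - f1 w)%C)
    by (intros; apply cder_minus; [apply H2|apply H1]).
  assert (K2 : forall w, cder (fun w => f2 w - f1 w)%C w (f3 w - f2 w)%C)
    by (intros; apply cder_minus; [apply H3|apply H2]).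
  assert (B1 : forall w, cder (fun w => f w - 1)%C w (f1 w)).
  { intros w. replace (f1 w) with (f1 w - 0)%C by ring.
    apply cder_minus; [apply H1|apply cder_const]. }
  destruct (jet2_ln_Cmod f1 f2 f3 z H2 H3 G1) as [k1 J1].
  destruct (jet2_ln_Cmod _ _ _ z K1 K2 G2) as [k2 J2].
  destruct (jet2_ln_Cmod f f1 f2 z H1 H2 G3) as [k3 J3].
  destruct (jet2_ln_Cmod _ f1 f2 z B1 H2 G4) as [k4 J4].
  destruct (jet2_phi_ln_Cmod f f1 f2 z H1 H2 G3) as [k5 J5].
  destruct (jet2_phi_ln_Cmod _ f1 f2 z B1 H2 G4) as [k6 J6].
  set (e5 := 4 / 10000 / (cosh2 (ln (Cmod (f z))) * cosh2 (ln (Cmod (f z))))) in *.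
  set (e6 := 4 / 10000 / (cosh2 (ln (Cmod (f z - 1))) * cosh2 (ln (Cmod (f z - 1))))) in *.
  set (r := rho z0 R0 z) in *.
  assert (HT : forall th, 17 * Re (th * th * k1) + 12 * Re (th * th * k2) + -19 * Re (th * th * k3)
     + -11 * Re (th * th * k4) + (e5 * Re (th * (f1 z / f z)) ^ 2 + Re (th * th * k5))
     + (e6 * Re (th * (f1 z / (f z - 1))) ^ 2 + Re (th * th * k6))
     + 29 * (- / r ^ 2 * ((-2 * (Re (z - z0) * Re th + Im (z - z0) * Im th)) *
          (-2 * (Re (z - z0) * Re th + Im (z - z0) * Im th)))
       + / r * (-2 * (Re th ^ 2 + Im th ^ 2))) <= 0).
  { intros th. destruct (J5 th) as [a5 J5'], (J6 th) as [a6 J6'].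
    destruct (jet2_ln_rho z0 z th R0 Hr) as [a7 J7].
    assert (J := jet2_plus _ _ _ _ _ _ (jet2_plus _ _ _ _ _ _ (jet2_plus _ _ _ _ _ _
      (jet2_plus _ _ _ _ _ _ (jet2_plus _ _ _ _ _ _ (jet2_plus _ _ _ _ _ _
      (jet2_scal 17 _ _ _ (J1 th)) (jet2_scal 12 _ _ _ (J2 th))) (jet2_scal (-19) _ _ _ (J3 th)))
      (jet2_scal (-11) _ _ _ (J4 th))) J5') J6') (jet2_scal 29 _ _ _ J7)).
    cbv beta in J. apply (jet2_max _ _ _ J).
    set (line := fun s : R => (z + RtoC s * th)%C).
    assert (L0 : line 0 = z) by (unfold line; ring).
    assert (Cl : ccont line 0) by exact (rder_cont _ _ _ (rder_line z th 0)).
    assert (Hm2 := Hmax). rewrite <- L0 in Hm2.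
    generalize (Cl _ Hm2). unfold filtermap. apply filter_imp. intros s Hs.
    rewrite L0 in Hs. unfold potential in Hs.
    fold (line 0) (line s). rewrite L0. exact Hs. }
  assert (T1 := HT (RtoC 1)). assert (T2 := HT Ci).
  assert (S5 := Re_sqr_sum (f1 z / f z)). assert (S6 := Re_sqr_sum (f1 z / (f z - 1))).
  assert (Z1 := Re_sum k1). assert (Z2 := Re_sum k2). assert (Z3 := Re_sum k3).
  assert (Z4 := Re_sum k4). assert (Z5 := Re_sum k5). assert (Z6 := Re_sum k6).
  assert (Ec := Cmod2_alt (z - z0)).
  assert (Hrr : Re (z - z0) ^ 2 + Im (z - z0) ^ 2 = R0 ^ 2 - r) by (rewrite <- Ec; unfold r, rho; ring).
  change (Re (RtoC 1)) with 1 in T1. change (Im (RtoC 1)) with 0 in T1.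
  change (Re Ci) with 0 in T2. change (Im Ci) with 1 in T2.
  assert (Fin : e5 * Cmod (f1 z / f z) ^ 2 + e6 * Cmod (f1 z / (f z - 1)) ^ 2 <= 116 * R0 ^ 2 / r ^ 2).
  { rewrite <- S5, <- S6.
    replace (116 * R0 ^ 2 / r ^ 2) with (116 / r ^ 2 * (R0 ^ 2 - r) + 116 / r) by (field; lra).
    rewrite <- Hrr.
    replace (116 / r ^ 2 * (Re (z - z0) ^ 2 + Im (z - z0) ^ 2) + 116 / r) with
      (- (29 * (- / r ^ 2 * (-2 * (Re (z - z0) * 1 + Im (z - z0) * 0) *
           (-2 * (Re (z - z0) * 1 + Im (z - z0) * 0))) + / r * (-2 * (1 ^ 2 + 0 ^ 2))))
       - (29 * (- / r ^ 2 * (-2 * (Re (z - z0) * 0 + Im (z - z0) * 1) *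
           (-2 * (Re (z - z0) * 0 + Im (z - z0) * 1))) + / r * (-2 * (0 ^ 2 + 1 ^ 2)))))
      by (field; lra).
    lra. }
  rewrite !Cmod_div in Fin by assumption.
  assert (P3 : 0 < Cmod (f z)) by (apply Cmod_gt_0; assumption).
  assert (P4 : 0 < Cmod (f z - 1)) by (apply Cmod_gt_0; assumption).
  assert (Q3 := cosh2_ge2 (ln (Cmod (f z)))). assert (Q4 := cosh2_ge2 (ln (Cmod (f z - 1)))).
  unfold e5, e6 in Fin.
  set (P := cosh2 (ln (Cmod (f z)))) in *. set (Q := cosh2 (ln (Cmod (f z - 1)))) in *.
  set (x := Cmod (f z)) in *. set (y := Cmod (f z - 1)) in *. set (v := Cmod (f1 z)) in *.
  replace ((v / (x * P)) ^ 2 + (v / (y * Q)) ^ 2) with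
    (2500 * (4 / 10000 / (P * P) * (v / x) ^ 2 + 4 / 10000 / (Q * Q) * (v / y) ^ 2)) by (field; lra).
  replace (290000 * R0 ^ 2 / r ^ 2) with (2500 * (116 * R0 ^ 2 / r ^ 2)) by (field; lra).
  lra.
Qed.

(** * Elementary estimates for the logarithms of the four moduli *)

Lemma exp_le (a b : R) : a <= b -> exp a <= exp b.
Proof. intros [H | ->]; [left; apply exp_increasing, H|lra]. Qed.

Lemma exp_le_inv (a b : R) : exp a <= exp b -> a <= b.
Proof. intros H. apply Rnot_lt_le. intros H1. apply exp_increasing in H1. lra. Qed.

Lemma exp1_ge2 : 2 <= exp 1.
Proof. assert (H := exp_ineq1_le 1). lra. Qed.

Lemma exp_m1_le : exp (-1) <= 1 / 2.
Proof.
  replace (-1) with (- (1)) by ring. rewrite exp_Ropp. assert (H := exp1_ge2).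
  apply Rmult_le_reg_r with (exp 1); [lra|]. rewrite Rinv_l by lra. lra.
Qed.

(** Both exponentials are at most exp(|L| / 100), and 2 <= e. *)
Lemma phi_le (L : R) : phi L <= 1 + Rabs L / 100.
Proof.
  unfold phi. apply exp_le_inv. rewrite exp_ln by (assert (H := cosh2_ge2 L); lra).
  rewrite exp_plus. unfold cosh2. assert (H := exp1_ge2).
  assert (H1 : exp (L / 100) <= exp (Rabs L / 100)).
  { apply exp_le. assert (H1 := Rle_abs L). lra. }
  assert (H2 : exp (- (L / 100)) <= exp (Rabs L / 100)).
  { apply exp_le. assert (H2 := Rle_abs (- L)). rewrite Rabs_Ropp in H2. lra. }
  assert (H3 := exp_pos (Rabs L / 100)). nra.
Qed.

(** [X] and [Y] stand for log |f| and log |f - 1|, and the hypotheses for the triangle inequality.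
    If |f| <= 1/e <= 1/2, then |f - 1| lies between 1/2 and 3/2, hence between 1/e and e. *)
Lemma log_relation (X Y : R) : Rabs (exp X - exp Y) <= 1 -> 1 <= exp X + exp Y ->
  X <= -1 -> -1 <= Y <= 1.
Proof.
  intros Hd Hs HX. apply Rabs_le_between in Hd.
  assert (H1 := exp_le _ _ HX). assert (H2 := exp_m1_le). assert (H3 := exp1_ge2).
  split; apply exp_le_inv; lra.
Qed.

Lemma log_relation_far (X Y : R) : exp Y <= exp X + 1 -> -1 <= X -> Y <= X + 2.
Proof.
  intros Hd HX. apply exp_le_inv. replace (X + 2) with (X + (1 + 1)) by ring. rewrite !exp_plus.
  assert (H1 : exp 0 <= exp X * exp 1) by (rewrite <- exp_plus; apply exp_le; lra).
  rewrite exp_0 in H1. assert (H2 := exp1_ge2). assert (H3 := exp_pos X).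
  assert (H4 : 0 <= exp X * exp 1 * (exp 1 - 2)) by (apply Rmult_le_pos; lra).
  assert (H5 : 0 <= exp X * (exp 1 - 2)) by (apply Rmult_le_pos; lra). lra.
Qed.

(* The exponents 17, 12, 19, 11 and 1/100 satisfy 19 < (17 + 12) (2/3), 11 < 12, 11 < 17 (2/3) and
   19 + 11 > 17 + 12, with room for the factors coming from [phi]. *)
Lemma potential_bound (X Y V D T : R) :
  Rabs (exp X - exp Y) <= 1 -> 1 <= exp X + exp Y -> D <= 1 + Rmax V X ->
  V - X - phi X <= T -> V - Y - phi Y <= T ->
  17 * V + 12 * D + -19 * X + -11 * Y + phi X + phi Y <= 100 + Rmax (17 * T) (29 * T).
Proof.
  intros Hd Hs HD HX HY.
  assert (PX := phi_le X). assert (PY := phi_le Y).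
  assert (R1 := log_relation X Y Hd Hs).
  assert (R2 := log_relation Y X ltac:(rewrite Rabs_minus_sym; exact Hd) ltac:(lra)).
  assert (Hd' := Hd). apply Rabs_le_between in Hd'.
  assert (R3 := log_relation_far X Y ltac:(lra)).
  assert (R4 := log_relation_far Y X ltac:(lra)).
  assert (M1 := Rmax_l (17 * T) (29 * T)). assert (M2 := Rmax_r (17 * T) (29 * T)).
  (* If V exceeds X, then 12 D counts as 12 V and the weight of V rises from 17 to 29. Near f = 0
     the bound on V through Y costs only a constant while the one through X absorbs -19 X; near f =
     1 the roles are exchanged; elsewhere X and Y differ by at most 2. Each case is linear. *)
  unfold Rmax in HD. destruct (Rle_dec V X);
  destruct (Rle_lt_dec X (-1)) as [C1|C1]; try specialize (R1 C1);
  destruct (Rle_lt_dec Y (-1)) as [C2|C2]; try specialize (R2 C2);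
  try specialize (R3 ltac:(lra)); try specialize (R4 ltac:(lra));
  unfold Rabs in PX, PY; destruct (Rcase_abs X), (Rcase_abs Y); lra.
Qed.

(** * Existence of a maximum *)

(** The bisection invariant is that every point of the square is matched or beaten by some point of
    the current rectangle. If all quadrants failed, each would have a point of the square beating it
    entirely; the best of these four points would beat the whole rectangle. By continuity the limit
    point is a maximum. *)
Lemma max_on_square (M : C -> R) (a b c d : R) : a <= b -> c <= d ->
  (forall z, @continuous C_UniformSpace R_UniformSpace M z) ->
  exists z1, forall x y, a <= x <= b -> c <= y <= d -> M (x, y) <= M z1.
Proof.
  intros Hab Hcd HM.
  destruct (bisection (fun x0 x1 y0 y1 => forall x y, a <= x <= b -> c <= y <= d ->
     exists x' y', x0 <= x' <= x1 /\ y0 <= y' <= y1 /\ M (x, y) <= M (x', y')) a b c d Hab Hcd)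
    as [u [v [_ [_ Hn]]]].
  - intros x0 x1 y0 y1 HP. apply NNPP. intros Hno.
    assert (N : forall x0' x1' y0' y1', half x0 x1 x0' x1' -> half y0 y1 y0' y1' ->
      exists x y, a <= x <= b /\ c <= y <= d /\ forall x' y', x0' <= x' <= x1' -> y0' <= y' <= y1' ->
        M (x', y') < M (x, y)).
    { intros x0' x1' y0' y1' H1 H2. apply NNPP. intros H3. apply Hno.
      exists x0', x1', y0', y1'. split; [exact H1|]. split; [exact H2|].
      intros x y Hx Hy. apply NNPP. intros H4. apply H3. exists x, y. split; [exact Hx|].
      split; [exact Hy|]. intros x' y' Hx' Hy'. apply Rnot_le_lt. intros H5. apply H4.
      exists x', y'. auto. }
    assert (Better : forall p q, (exists x y, a <= x <= b /\ c <= y <= d /\ p <= M (x, y)) ->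
       (exists x y, a <= x <= b /\ c <= y <= d /\ q <= M (x, y)) ->
       exists x y, a <= x <= b /\ c <= y <= d /\ p <= M (x, y) /\ q <= M (x, y)).
    { intros p q [x [y [Hx [Hy Hp]]]] [x' [y' [Hx' [Hy' Hq]]]].
      destruct (Rle_lt_dec (M (x, y)) (M (x', y'))).
      - exists x', y'. repeat split; lra.
      - exists x, y. repeat split; lra. }
    assert (hl : forall p q, half p q p ((p + q) / 2)) by (intros; left; split; reflexivity).
    assert (hr : forall p q, half p q ((p + q) / 2) q) by (intros; right; split; reflexivity).
    destruct (N _ _ _ _ (hl x0 x1) (hl y0 y1)) as [p1 [q1 [A1 [B1 N1]]]].
    destruct (N _ _ _ _ (hl x0 x1) (hr y0 y1)) as [p2 [q2 [A2 [B2 N2]]]].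
    destruct (N _ _ _ _ (hr x0 x1) (hl y0 y1)) as [p3 [q3 [A3 [B3 N3]]]].
    destruct (N _ _ _ _ (hr x0 x1) (hr y0 y1)) as [p4 [q4 [A4 [B4 N4]]]].
    destruct (Better (M (p1, q1)) (M (p2, q2))) as [s1 [t1 [S1 [T1 [E1 E2]]]]];
      [exists p1, q1; repeat split; lra|exists p2, q2; repeat split; lra|].
    destruct (Better (M (p3, q3)) (M (p4, q4))) as [s2 [t2 [S2 [T2 [E3 E4]]]]];
      [exists p3, q3; repeat split; lra|exists p4, q4; repeat split; lra|].
    destruct (Better (M (s1, t1)) (M (s2, t2))) as [s [t [S [T [E5 E6]]]]];
      [exists s1, t1; repeat split; lra|exists s2, t2; repeat split; lra|].
    destruct (HP s t S T) as [x' [y' [Hx' [Hy' H]]]].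
    destruct (Rle_lt_dec x' ((x0 + x1) / 2)), (Rle_lt_dec y' ((y0 + y1) / 2)).
    + specialize (N1 x' y' ltac:(lra) ltac:(lra)). lra.
    + specialize (N2 x' y' ltac:(lra) ltac:(lra)). lra.
    + specialize (N3 x' y' ltac:(lra) ltac:(lra)). lra.
    + specialize (N4 x' y' ltac:(lra) ltac:(lra)). lra.
  - intros x y Hx Hy. exists x, y. repeat split; lra.
  - exists (u, v). intros x y Hx Hy. apply Rnot_lt_le. intros Hlt.
    destruct (proj1 (filterlim_locally _ _) (HM (u, v)) (mkposreal (M (x, y) - M (u, v)) ltac:(lra)))
      as [e He].
    destruct (half_pow_small ((b - a) + (d - c)) e (cond_pos e)) as [n Hs].
    destruct (Hn n) as [x0 [x1 [y0 [y1 [HP [Hu [Hv [Ex Ey]]]]]]]].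
    destruct (HP x y Hx Hy) as [x' [y' [Hx' [Hy' H]]]].
    assert (H2n : 0 < / 2 ^ n) by (apply Rinv_0_lt_compat, pow_lt; lra).
    assert (W1 : 0 <= (b - a) / 2 ^ n) by (apply Rmult_le_pos; lra).
    assert (W2 : 0 <= (d - c) / 2 ^ n) by (apply Rmult_le_pos; lra).
    assert (Es : ((b - a) + (d - c)) / 2 ^ n = (b - a) / 2 ^ n + (d - c) / 2 ^ n) by (unfold Rdiv; ring).
    specialize (He (x', y')). 
    assert (Hb : @ball C_UniformSpace (u, v) e (x', y')).
    { split; simpl.
      - change (Rabs (x' - u) < e). apply Rabs_def1; lra.
      - change (Rabs (y' - v) < e). apply Rabs_def1; lra. }
    specialize (He Hb). change (Rabs (M (x', y') - M (u, v)) < M (x, y) - M (u, v)) in He.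
    apply Rabs_def2 in He. lra.
Qed.

(** * Local factorisations and the continuity of L *)

Lemma cder_pow (z0 z : C) (n : nat) :
  cder (fun w => (w - z0) ^ S n)%C z (RtoC (INR (S n)) * (z - z0) ^ n)%C.
Proof.
  assert (D1 : cder (fun w => w - z0)%C z (1 - 0)%C)
    by (apply cder_minus; [apply cder_id|apply cder_const]).
  induction n as [|n IH].
  - replace (RtoC (INR 1) * (z - z0) ^ 0)%C with (1 - 0)%C by (simpl; ring).
    apply cder_ext with (2 := D1). intros w. simpl. ring.
  - replace (RtoC (INR (S (S n))) * (z - z0) ^ S n)%C with
      ((1 - 0) * (z - z0) ^ S n + (z - z0) * (RtoC (INR (S n)) * (z - z0) ^ n))%C.
    + exact (cder_mult _ _ z _ _ D1 IH).
    + rewrite (S_INR (S n)), RtoC_plus. simpl Cpow. ring.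
Qed.

(** If F has order n + 1 at [z0], the cofactor of F' is (n + 1) g + (z - z0) g', which is nonzero at
    [z0]. So F' has order exactly n, and the values of F' and F'' at [z0] decide between n = 0, n =
    1 and n >= 2. *)
Lemma zero_structure (F F1 F2 : C -> C) (z0 : C) :
  (forall z, cder F z (F1 z)) -> (forall z, cder F1 z (F2 z)) ->
  ~ (forall z, F z = RtoC 0) -> F z0 = RtoC 0 ->
  exists n g a, (forall z, F z = (z - z0) ^ S n * g z)%C /\ (forall z, F1 z = (z - z0) ^ n * a z)%C /\
    cont_all g /\ cont_all a /\ g z0 <> RtoC 0 /\
    (F1 z0 <> RtoC 0 -> n = 0%nat) /\
    (F1 z0 = RtoC 0 -> F2 z0 = RtoC 0 -> (2 <= n)%nat).
Proof.
  intros H1 H2 Hn Hz.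
  assert (HF : holo F) by (intros z; exists (F1 z); apply H1).
  destruct (holo_order F z0 HF Hn) as [m [g [Hg [Hg0 He]]]].
  assert (Z0 : (z0 - z0)%C = RtoC 0) by ring.
  destruct m as [|n].
  { exfalso. apply Hg0. rewrite <- Hz, He. simpl. ring. }
  destruct (holo_derivative g Hg) as [g1 [Hg1 Hg1h]].
  set (a := fun z => (RtoC (INR (S n)) * g z + (z - z0) * g1 z)%C).
  assert (Ha : cont_all a).
  { intros z. apply ccont_plus; apply ccont_mult.
    - apply ccont_const.
    - apply holo_cont, Hg.
    - apply ccont_minus; [apply ccont_id|apply ccont_const].
    - apply holo_cont, Hg1h. }
  assert (Ea : forall z, F1 z = ((z - z0) ^ n * a z)%C).
  { intros z. apply cder_unique with F z; [apply H1|].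
    apply cder_ext with (fun w => (w - z0) ^ S n * g w)%C; [intros; symmetry; apply He|].
    assert (D := cder_mult _ _ z _ _ (cder_pow z0 z n) (Hg1 z)). cbv beta in D.
    replace ((z - z0) ^ n * a z)%C with
      (RtoC (INR (S n)) * (z - z0) ^ n * g z + (z - z0) ^ S n * g1 z)%C
      by (unfold a; simpl Cpow; ring). exact D. }
  assert (Ha0 : a z0 <> RtoC 0).
  { unfold a. rewrite Z0. replace (RtoC (INR (S n)) * g z0 + 0 * g1 z0)%C
      with (RtoC (INR (S n)) * g z0)%C by ring.
    apply Cmult_neq_0; [|exact Hg0]. intros K. apply RtoC_inj in K. revert K. apply not_0_INR. lia. }
  exists n, g, a. split; [exact He|]. split; [exact Ea|]. split; [apply holo_cont, Hg|].
  split; [exact Ha|]. split; [exact Hg0|]. split.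
  - intros Hne. destruct n as [|n]; [reflexivity|]. exfalso. apply Hne. rewrite Ea, Z0. simpl. ring.
  - intros E1 E2. destruct n as [|[|n]]; [| |lia]; exfalso; apply Ha0.
    + rewrite <- E1, Ea. simpl. ring.
    + rewrite <- E2. apply cder_unique with F1 z0; [|apply H2].
      exists a. split; [apply Ha|]. split; [reflexivity|]. intros w. rewrite !Ea, Z0. simpl. ring.
Qed.

(** The function L itself, extended by 0 to the points where one of the four functions vanishes. The
    case distinction is not decidable and needs the informative excluded middle. *)
Definition lam (f f1 : C -> C) (z : C) : R :=
  if excluded_middle_informative (generic f f1 z) then exp (potential f f1 z) else 0.

Lemma ln_Cmod_upper (h : C -> C) (z : C) : @ccont C_UniformSpace h z ->
  exists A, 0 <= A /\
    @locally C_UniformSpace z (fun w => h w <> RtoC 0 -> ln (Cmod (h w)) <= A).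
Proof.
  intros H. exists (Cmod (h z)). split; [apply Cmod_ge_0|].
  generalize (proj1 (ccont_eps h z) H 1 Rlt_0_1). apply filter_imp. intros w Hw Hn.
  apply exp_le_inv. rewrite exp_ln by (apply Cmod_gt_0, Hn).
  eapply Rle_trans; [|apply exp_ineq1_le].
  assert (T := Cmod_triangle (h w - h z) (h z)).
  replace (h w - h z + h z)%C with (h w) in T by ring. lra.
Qed.

Lemma ln_Cmod_lower (h : C -> C) (z : C) : @ccont C_UniformSpace h z -> h z <> RtoC 0 ->
  exists A, 0 <= A /\ @locally C_UniformSpace z (fun w => h w <> RtoC 0 /\ - A <= ln (Cmod (h w))).
Proof.
  intros H Hn. exists (Rmax 0 (- ln (Cmod (h z) / 2))). split; [apply Rmax_l|].
  assert (Hp := proj1 (Cmod_gt_0 _) Hn).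
  generalize (ccont_ne0 h z H Hn). apply filter_imp. intros w Hw.
  split; [apply Cmod_pos_ne0; lra|].
  assert (M := Rmax_r 0 (- ln (Cmod (h z) / 2))).
  assert (L : ln (Cmod (h z) / 2) <= ln (Cmod (h w))) by (left; apply ln_increasing; lra). lra.
Qed.

Lemma ln_Cmod_pow_mult (u v : C) (n : nat) : u <> RtoC 0 -> v <> RtoC 0 ->
  ln (Cmod (u ^ n * v)) = INR n * ln (Cmod u) + ln (Cmod v).
Proof.
  intros Hu Hv. apply Cmod_gt_0 in Hu. apply Cmod_gt_0 in Hv.
  rewrite Cmod_mult, Cmod_pow, ln_mult, ln_pow; [reflexivity|exact Hu|apply pow_lt, Hu|exact Hv].
Qed.

(** The exponents i and j may be lower bounds for the orders, as f' and f' - f occur with positive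
    powers; f and f - 1 occur with negative ones, so their cofactors must not vanish. P(|f|) and
    P(|f - 1|) cost at most 1/100 per order, which gives 1901/100 and 1101/100; the slack 1/2 makes
    L of size O(|z - z0|^(1/2)). *)
Lemma lam_vanish (f f1 a b c d : C -> C) (z0 : C) (i j k l : nat) :
  cont_all a -> cont_all b -> cont_all c -> cont_all d ->
  c z0 <> RtoC 0 -> d z0 <> RtoC 0 ->
  (forall z, f1 z = (z - z0) ^ i * a z)%C -> (forall z, f1 z - f z = (z - z0) ^ j * b z)%C ->
  (forall z, f z = (z - z0) ^ k * c z)%C -> (forall z, f z - 1 = (z - z0) ^ l * d z)%C ->
  ~ generic f f1 z0 ->
  1901 / 100 * INR k + 1101 / 100 * INR l + 1 / 2 <= 17 * INR i + 12 * INR j ->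
  @continuous C_UniformSpace R_UniformSpace (lam f f1) z0.
Proof.
  intros Ca Cb Cc Cd Nc Nd E1 E2 E3 E4 Hng Hexp.
  destruct (ln_Cmod_upper a z0 (Ca z0)) as [A1 [PA1 LA1]].
  destruct (ln_Cmod_upper b z0 (Cb z0)) as [A2 [PA2 LA2]].
  destruct (ln_Cmod_upper c z0 (Cc z0)) as [A3 [PA3 LA3]].
  destruct (ln_Cmod_upper d z0 (Cd z0)) as [A4 [PA4 LA4]].
  destruct (ln_Cmod_lower c z0 (Cc z0) Nc) as [A5 [PA5 LA5]].
  destruct (ln_Cmod_lower d z0 (Cd z0) Nd) as [A6 [PA6 LA6]].
  set (A := A1 + A2 + A3 + A4 + A5 + A6).
  assert (L0 : lam f f1 z0 = 0).
  { unfold lam. destruct (excluded_middle_informative (generic f f1 z0)); [contradiction|reflexivity]. }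
  apply filterlim_locally. intros eps. rewrite L0.
  (* [B] bounds all of log L except the terms in r = log |w - z0|; its summand 2 comes from the two
     uses of [phi_le]. Then log L <= B + r / 2, which is below log eps once r < 2 (log eps - B). *)
  set (B := 100 * A + 2).
  set (del := Rmin 1 (exp (2 * (ln eps - B)))).
  assert (Hdel : 0 < del) by (apply Rmin_pos; [lra|apply exp_pos]).
  assert (Hball : @locally C_UniformSpace z0 (fun w => Cmod (w - z0) < del)).
  { apply locally_Cmod. exists del. split; [exact Hdel|auto]. }
  generalize (filter_and _ _ LA1 (filter_and _ _ LA2 (filter_and _ _ LA3 (filter_and _ _ LA4
    (filter_and _ _ LA5 (filter_and _ _ LA6 Hball)))))).
  apply filter_imp. intros w [B1 [B2 [B3 [B4 [[N5 B5] [[N6 B6] Hw]]]]]].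
  change (Rabs (lam f f1 w - 0) < eps). rewrite Rminus_0_r. unfold lam.
  destruct (excluded_middle_informative (generic f f1 w)) as [[G1 [G2 [G3 G4]]]|_];
    [|rewrite Rabs_R0; apply cond_pos].
  rewrite Rabs_pos_eq by (left; apply exp_pos).
  assert (Hne : w <> z0) by (intros ->; apply Hng; repeat split; assumption).
  assert (Hu := Csub_ne0 w z0 Hne).
  assert (N1 : a w <> RtoC 0) by (intros K; apply G1; rewrite E1, K; ring).
  assert (N2 : b w <> RtoC 0) by (intros K; apply G2; rewrite E2, K; ring).
  specialize (B1 N1). specialize (B2 N2). specialize (B3 N5). specialize (B4 N6).
  rewrite <- (exp_ln eps) by apply cond_pos. apply exp_increasing.
  unfold potential. rewrite E2, E4, E1, E3.
  rewrite !ln_Cmod_pow_mult by assumption.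
  set (r := ln (Cmod (w - z0))) in *.
  assert (Hup := proj1 (Cmod_gt_0 _) Hu).
  assert (Hr : r < 0).
  { unfold r. rewrite <- ln_1. apply ln_increasing; [exact Hup|].
    eapply Rlt_le_trans; [exact Hw|apply Rmin_l]. }
  assert (Hr2 : r < 2 * (ln eps - B)).
  { unfold r. apply exp_lt_inv. rewrite exp_ln by exact Hup.
    eapply Rlt_le_trans; [exact Hw|apply Rmin_r]. }
  assert (PX := phi_le (INR k * r + ln (Cmod (c w)))).
  assert (PY := phi_le (INR l * r + ln (Cmod (d w)))).
  assert (Kr : INR k * r <= 0) by (assert (H := pos_INR k); nra).
  assert (Lr : INR l * r <= 0) by (assert (H := pos_INR l); nra).
  assert (AX : Rabs (INR k * r + ln (Cmod (c w))) <= A - INR k * r)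
    by (apply Rabs_le; unfold A; lra).
  assert (AY : Rabs (INR l * r + ln (Cmod (d w))) <= A - INR l * r)
    by (apply Rabs_le; unfold A; lra).
  assert (Hlin : 17 * (INR i * r) + 12 * (INR j * r) - 1901 / 100 * (INR k * r)
     - 1101 / 100 * (INR l * r) <= 1 / 2 * r) by nra.
  unfold B, A in *. lra.
Qed.

Lemma Cone_ne0 : RtoC 1 <> RtoC 0.
Proof. intros K. apply RtoC_inj in K. lra. Qed.

Lemma lam_continuous_generic (f f1 : C -> C) (z : C) : cont_all f -> cont_all f1 ->
  generic f f1 z -> @continuous C_UniformSpace R_UniformSpace (lam f f1) z.
Proof.
  intros Hf Hf1 [G1 [G2 [G3 G4]]].
  assert (Cl : forall h : C -> C, @ccont C_UniformSpace h z -> h z <> RtoC 0 ->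
    @continuous C_UniformSpace R_UniformSpace (fun w => ln (Cmod (h w))) z).
  { intros h Hh Hn. apply (continuous_comp (fun w => Cmod (h w)) ln).
    - apply continuous_Cmod, Hh.
    - apply (ex_derive_continuous (V:=R_NormedModule)). auto_derive. apply Cmod_gt_0, Hn. }
  assert (Cp : forall h : C -> C, @ccont C_UniformSpace h z -> h z <> RtoC 0 ->
    @continuous C_UniformSpace R_UniformSpace (fun w => phi (ln (Cmod (h w)))) z).
  { intros h Hh Hn. apply (continuous_comp (fun w => ln (Cmod (h w))) phi); [apply Cl; assumption|].
    apply (ex_derive_continuous (V:=R_NormedModule)). eexists. apply phi_der. }
  assert (K : @ccont C_UniformSpace (fun w => f1 w - f w)%C z) by (apply ccont_minus; [apply Hf1|apply Hf]).
  assert (B : @ccont C_UniformSpace (fun w => f w - 1)%C z)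
    by (apply ccont_minus; [apply Hf|apply ccont_const]).
  apply continuous_ext_loc with (fun w => exp (potential f f1 w)).
  - generalize (filter_and _ _ (ccont_ne0 f1 z (Hf1 z) G1) (filter_and _ _ (ccont_ne0 _ z K G2)
      (filter_and _ _ (ccont_ne0 f z (Hf z) G3) (ccont_ne0 _ z B G4)))).
    apply filter_imp. intros w [W1 [W2 [W3 W4]]].
    apply Cmod_gt_0 in G1. apply Cmod_gt_0 in G2. apply Cmod_gt_0 in G3. apply Cmod_gt_0 in G4.
    assert (G : generic f f1 w) by (repeat split; apply Cmod_pos_ne0; simpl in *; lra).
    unfold lam. destruct (excluded_middle_informative (generic f f1 w)); [reflexivity|contradiction].
  - apply (continuous_comp (potential f f1) exp).
    + unfold potential.
      repeat apply (continuous_plus (V:=R_NormedModule));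
        try (apply (continuous_scal_r (V:=R_NormedModule)));
        first [apply (Cl f1)|apply (Cl (fun w => f1 w - f w)%C)|apply (Cl f)
          |apply (Cl (fun w => f w - 1)%C)|apply (Cp f)|apply (Cp (fun w => f w - 1)%C)];
        first [assumption|apply Hf|apply Hf1].
    + apply (ex_derive_continuous (V:=R_NormedModule)). auto_derive. trivial.
Qed.

Lemma lam_continuous (f f1 f2 : C -> C) (z : C) :
  (forall w, cder f w (f1 w)) -> (forall w, cder f1 w (f2 w)) ->
  ~ (forall w, f w = RtoC 0) -> ~ (forall w, (f w - 1)%C = RtoC 0) ->
  (f z = RtoC 0 -> f1 z = RtoC 0 /\ f2 z = RtoC 0) ->
  (f z = RtoC 1 -> f1 z = RtoC 1 \/ (f1 z = RtoC 0 /\ f2 z = RtoC 0)) ->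
  @continuous C_UniformSpace R_UniformSpace (lam f f1) z.
Proof.
  intros H1 H2 Nf Nb Z0 Z1.
  assert (Cf := cder_cont_all _ _ H1). assert (Cf1 := cder_cont_all _ _ H2).
  assert (B1 : forall w, cder (fun w => f w - 1)%C w (f1 w)).
  { intros w. replace (f1 w) with (f1 w - 0)%C by ring.
    apply cder_minus; [apply H1|apply cder_const]. }
  assert (Cb : cont_all (fun w => f w - 1)%C) by exact (cder_cont_all _ _ B1).
  assert (Ck : cont_all (fun w => f1 w - f w)%C) by (intros w; apply ccont_minus; [apply Cf1|apply Cf]).
  assert (Hk : holo (fun w => f1 w - f w)%C).
  { intros w. exists (f2 w - f1 w)%C. apply cder_minus; [apply H2|apply H1]. }
  assert (Zz : (z - z)%C = RtoC 0) by ring.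
  destruct (Ceq_dec (f z) (RtoC 0)) as [E0|E0].
  { destruct (Z0 E0) as [E1 E2].
    destruct (zero_structure f f1 f2 z H1 H2 Nf E0) as [n [g [a [Eg [Ea [Cg [Ca [Ng [_ Hn]]]]]]]]].
    specialize (Hn E1 E2).
    (* The requirement 29 n >= 19.01 (n + 1) + 0.5 holds for n = 2 with 58 against 57.53, and fails
       for n = 1: zeros of order 2 would not do. *)
    apply (lam_vanish f f1 a (fun w => a w - (w - z) * g w)%C g (fun w => f w - 1)%C z n n (S n) 0);
      try assumption.
    - intros w. apply ccont_minus; [apply Ca|]. apply ccont_mult; [|apply Cg].
      apply ccont_minus; [apply ccont_id|apply ccont_const].
    - rewrite E0. intros K. apply Cone_ne0. replace (RtoC 1) with (- (0 - 1))%C by ring.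
      rewrite K. ring.
    - intros w. rewrite Ea, Eg. simpl. ring.
    - intros w. simpl. ring.
    - intros [_ [_ [G _]]]. exact (G E0).
    - rewrite S_INR. apply le_INR in Hn. simpl in *. lra. }
  destruct (Ceq_dec (f z - 1)%C (RtoC 0)) as [E1|E1].
  { assert (E1' : f z = RtoC 1) by (replace (f z) with (f z - 1 + 1)%C by ring; rewrite E1; ring).
    destruct (zero_structure _ f1 f2 z B1 H2 Nb E1) as [n [g [a [Eg [Ea [Cg [Ca [Ng [Hn0 Hn]]]]]]]]].
    assert (Hng : ~ generic f f1 z) by (intros [_ [_ [_ G]]]; exact (G E1)).
    destruct (Z1 E1') as [E2|[E2 E3]].
    - rewrite Hn0 in Eg by (rewrite E2; apply Cone_ne0).
      destruct (holo_factor _ z Hk) as [q [Hq [_ Eq]]]. cbv beta in Eq.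
      (* At a simple 1-point with f' = 1 the difference f' - f vanishes too, and 12 >= 11.01 +
         0.5. *)
      apply (lam_vanish f f1 f1 q f g z 0 1 0 1); try assumption.
      + apply holo_cont, Hq.
      + intros w. simpl. ring.
      + intros w. rewrite Eq, E2, E1'. simpl. ring.
      + intros w. simpl. ring.
      + simpl. lra.
    - specialize (Hn E2 E3).
      (* Here 17 n >= 11.01 (n + 1) + 0.5 is needed: 34 against 33.53 for n = 2. *)
      apply (lam_vanish f f1 a (fun w => f1 w - f w)%C f g z n 0 0 (S n)); try assumption.
      + intros w. simpl. ring.
      + intros w. simpl. ring.
      + rewrite S_INR. apply le_INR in Hn. simpl in *. lra. }
  (* At the remaining zeros of f' and of f' - f nothing competes with the positive exponents. *)
  destruct (Ceq_dec (f1 z) (RtoC 0)) as [E2|E2].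
  { destruct (holo_factor f1 z ltac:(intros w; exists (f2 w); apply H2)) as [q [Hq [_ Eq]]].
    apply (lam_vanish f f1 q (fun w => f1 w - f w)%C f (fun w => f w - 1)%C z 1 0 0 0); try assumption.
    - apply holo_cont, Hq.
    - intros w. rewrite Eq, E2. simpl. ring.
    - intros w. simpl. ring.
    - intros w. simpl. ring.
    - intros w. simpl. ring.
    - intros [G _]. exact (G E2).
    - simpl. lra. }
  destruct (Ceq_dec (f1 z - f z)%C (RtoC 0)) as [E3|E3].
  { destruct (holo_factor _ z Hk) as [q [Hq [_ Eq]]]. cbv beta in Eq.
    apply (lam_vanish f f1 f1 q f (fun w => f w - 1)%C z 0 1 0 0); try assumption.
    - apply holo_cont, Hq.
    - intros w. simpl. ring.
    - intros w. rewrite Eq, E3. simpl. ring.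
    - intros w. simpl. ring.
    - intros w. simpl. ring.
    - intros [_ [G _]]. exact (G E3).
    - simpl. lra. }
  apply lam_continuous_generic; repeat split; assumption.
Qed.

(** None of the four functions vanishes identically, so all are free of zeros in a common punctured
    disc about 0. *)
Lemma generic_point (f f1 f2 : C -> C) :
  (forall w, cder f w (f1 w)) -> (forall w, cder f1 w (f2 w)) ->
  ~ (forall w, f w = RtoC 0) -> ~ (forall w, (f w - 1)%C = RtoC 0) ->
  ~ (forall w, f1 w = RtoC 0) -> ~ (forall w, (f1 w - f w)%C = RtoC 0) ->
  exists z, generic f f1 z.
Proof.
  intros H1 H2 Nf Nb N1 Nk.
  assert (Hf : holo f) by (intros w; exists (f1 w); apply H1).
  assert (Hf1 : holo f1) by (intros w; exists (f2 w); apply H2).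
  assert (Hb : holo (fun w => f w - 1)%C)
    by (intros w; exists (f1 w - 0)%C; apply cder_minus; [apply H1|apply cder_const]).
  assert (Hk : holo (fun w => f1 w - f w)%C)
    by (intros w; exists (f2 w - f1 w)%C; apply cder_minus; [apply H2|apply H1]).
  destruct (holo_isolated f 0 Hf Nf) as [d1 [D1 I1]].
  destruct (holo_isolated _ 0 Hb Nb) as [d2 [D2 I2]].
  destruct (holo_isolated f1 0 Hf1 N1) as [d3 [D3 I3]].
  destruct (holo_isolated _ 0 Hk Nk) as [d4 [D4 I4]].
  set (d := Rmin (Rmin d1 d2) (Rmin d3 d4)).
  assert (Hd : 0 < d) by (repeat apply Rmin_pos; assumption).
  assert (M1 := Rmin_l (Rmin d1 d2) (Rmin d3 d4)). assert (M2 := Rmin_r (Rmin d1 d2) (Rmin d3 d4)).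
  assert (M3 := Rmin_l d1 d2). assert (M4 := Rmin_r d1 d2).
  assert (M5 := Rmin_l d3 d4). assert (M6 := Rmin_r d3 d4).
  fold d in M1, M2.
  assert (Hz : Cmod (RtoC (d / 2) - 0) = d / 2).
  { replace (RtoC (d / 2) - 0)%C with (RtoC (d / 2)) by ring. rewrite Cmod_R, Rabs_pos_eq; lra. }
  assert (Hne : RtoC (d / 2) <> RtoC 0) by (intros K; apply RtoC_inj in K; lra).
  exists (RtoC (d / 2)). repeat split.
  - apply I3; [rewrite Hz; lra|exact Hne].
  - apply I4; [rewrite Hz; lra|exact Hne].
  - apply I1; [rewrite Hz; lra|exact Hne].
  - apply I2; [rewrite Hz; lra|exact Hne].
Qed.

(** * The maximum argument of Ahlfors type *)

Lemma rho_cont (z0 : C) (R0 : R) (z : C) : @continuous C_UniformSpace R_UniformSpace (rho z0 R0) z.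
Proof.
  apply (continuous_comp (fun w => Cmod (w - z0)) (fun s => R0 ^ 2 - s ^ 2)).
  - apply (continuous_Cmod (fun w => (w - z0)%C)).
    apply ccont_minus; [apply ccont_id|apply ccont_const].
  - apply (ex_derive_continuous (V:=R_NormedModule)). auto_derive. trivial.
Qed.

(** With r = rho at the maximum, the curvature bound reads w <= tau = 540 R0 / r, and L(z0) R0^58 <=
    L(z1) r^29 by maximality. For tau >= 1 the bound tau^29 cancels r^29 and leaves R0^(-29);
    otherwise tau^17 leaves r^12 <= R0^24, hence R0^(-17), the weaker of the two since R0 >= 1. *)
Lemma potential_decay (f f1 f2 f3 : C -> C) (z0 : C) (R0 : R) :
  (forall w, cder f w (f1 w)) -> (forall w, cder f1 w (f2 w)) -> (forall w, cder f2 w (f3 w)) ->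
  (forall w, @continuous C_UniformSpace R_UniformSpace (lam f f1) w) ->
  generic f f1 z0 -> 1 <= R0 ->
  potential f f1 z0 <= 100 + 29 * ln 540 - 17 * ln R0.
Proof.
  intros H1 H2 H3 Hlam G0 HR.
  (* Truncating rho at 0 makes M continuous on the plane and zero outside the disc, so its maximum
     over the circumscribed square is a global one. *)
  set (M := fun z => lam f f1 z * Rmax 0 (rho z0 R0 z) ^ 29).
  assert (HM : forall z, @continuous C_UniformSpace R_UniformSpace M z).
  { intros z. apply (continuous_mult (K:=R_AbsRing)); [apply Hlam|].
    apply (continuous_comp (fun w => Rmax 0 (rho z0 R0 w)) (fun s => s ^ 29)).
    - apply continuous_ext with (fun w => (rho z0 R0 w + Rabs (rho z0 R0 w)) / 2).
      + intros w. unfold Rmax, Rabs. destruct (Rle_dec 0 (rho z0 R0 w)), (Rcase_abs (rho z0 R0 w)); lra.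
      + apply (continuous_comp (rho z0 R0) (fun s => (s + Rabs s) / 2)); [apply rho_cont|].
        apply (continuous_mult (K:=R_AbsRing)); [|apply continuous_const].
        apply (continuous_plus (V:=R_NormedModule)); [apply continuous_id|apply continuous_Rabs].
    - apply (ex_derive_continuous (V:=R_NormedModule)). auto_derive. trivial. }
  destruct (max_on_square M (fst z0 - R0) (fst z0 + R0) (snd z0 - R0) (snd z0 + R0)
    ltac:(lra) ltac:(lra) HM) as [z1 Hz1].
  assert (Mpos : forall z, 0 <= M z).
  { intros z. apply Rmult_le_pos; [|apply pow_le, Rmax_l].
    unfold lam. destruct (excluded_middle_informative _); [left; apply exp_pos|lra]. }
  assert (Hmax : forall z, M z <= M z1).
  { intros z. destruct (Rle_lt_dec (rho z0 R0 z) 0) as [Hr|Hr].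
    - replace (M z) with 0; [apply Mpos|]. unfold M. rewrite Rmax_left by exact Hr.
      rewrite pow_i by lia. ring.
    - assert (Hc : Cmod (z - z0) < R0).
      { unfold rho in Hr. assert (H := Cmod_ge_0 (z - z0)). nra. }
      assert (P1 := re_le_Cmod (z - z0)).
      assert (P2 := Rle_trans _ _ _ (Rmax_r _ _) (Rmax_Cmod (z - z0)%C)).
      assert (Q1 : Rabs (fst z - fst z0) < R0) by exact (Rle_lt_trans _ _ _ P1 Hc).
      assert (Q2 : Rabs (snd z - snd z0) < R0) by exact (Rle_lt_trans _ _ _ P2 Hc).
      apply Rabs_def2 in Q1. apply Rabs_def2 in Q2.
      rewrite (surjective_pairing z). apply Hz1; lra. }
  assert (Mgen : forall z, generic f f1 z -> 0 < rho z0 R0 z ->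
    M z = exp (potential f f1 z + 29 * ln (rho z0 R0 z))).
  { intros z G Hr. unfold M, lam.
    destruct (excluded_middle_informative (generic f f1 z)); [|contradiction].
    rewrite Rmax_right by lra. rewrite exp_plus. f_equal.
    replace 29 with (INR 29) by (simpl; ring). rewrite <- ln_pow by exact Hr.
    rewrite exp_ln by (apply pow_lt, Hr). reflexivity. }
  assert (Hr0 : rho z0 R0 z0 = R0 ^ 2).
  { unfold rho. replace (z0 - z0)%C with (RtoC 0) by ring. rewrite Cmod_0. ring. }
  assert (Hr0p : 0 < rho z0 R0 z0) by (rewrite Hr0; nra).
  assert (M0 := Mgen z0 G0 Hr0p).
  assert (M1 : 0 < M z1).
  { eapply Rlt_le_trans; [|apply (Hmax z0)]. rewrite M0. apply exp_pos. }
  assert (G1 : generic f f1 z1).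
  { apply NNPP. intros Hn. unfold M, lam in M1.
    destruct (excluded_middle_informative (generic f f1 z1)); [contradiction|lra]. }
  assert (Hr1 : 0 < rho z0 R0 z1).
  { apply Rnot_le_lt. intros Hn. unfold M in M1. rewrite Rmax_left in M1 by exact Hn.
    rewrite pow_i in M1 by lia. lra. }
  assert (Lap : (Cmod (f1 z1) / (Cmod (f z1) * cosh2 (ln (Cmod (f z1))))) ^ 2
    + (Cmod (f1 z1) / (Cmod (f z1 - 1) * cosh2 (ln (Cmod (f z1 - 1))))) ^ 2
    <= 290000 * R0 ^ 2 / rho z0 R0 z1 ^ 2).
  { apply (laplacian_at_max f f1 f2 f3); try assumption.
    (* M > 0 forces genericity, so the continuity of M alone provides a whole neighbourhood of
       generic points, where M is the exponential of the sum to be compared. *)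
    assert (C1 : locally (M z1) (fun s => 0 < s)) by exact (open_gt 0 _ M1).
    assert (C2 : locally (rho z0 R0 z1) (fun s => 0 < s)) by exact (open_gt 0 _ Hr1).
    assert (D1 : @locally C_UniformSpace z1 (fun w => 0 < M w)) by exact (HM z1 _ C1).
    assert (D2 : @locally C_UniformSpace z1 (fun w => 0 < rho z0 R0 w))
      by exact (rho_cont z0 R0 z1 _ C2).
    generalize (filter_and _ _ D1 D2).
    apply filter_imp. intros w [W1 W2].
    assert (Gw : generic f f1 w).
    { apply NNPP. intros Hn. unfold M, lam in W1.
      destruct (excluded_middle_informative (generic f f1 w)); [contradiction|lra]. }
    apply exp_le_inv. rewrite <- !Mgen by assumption. apply Hmax. }
  destruct G1 as [A1 [A2 [A3 A4]]].
  assert (M2 := Mgen z1 ltac:(repeat split; assumption) Hr1).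
  assert (Hcmp := Hmax z0). rewrite M0, M2 in Hcmp. apply exp_le_inv in Hcmp.
  set (r := rho z0 R0 z1) in *.
  assert (Hrle : r <= R0 ^ 2).
  { unfold r, rho. assert (H := pow2_ge_0 (Cmod (z1 - z0))). lra. }
  unfold potential in Hcmp at 2.
  assert (P1 := proj1 (Cmod_gt_0 _) A1). assert (P2 := proj1 (Cmod_gt_0 _) A2).
  assert (P3 := proj1 (Cmod_gt_0 _) A3). assert (P4 := proj1 (Cmod_gt_0 _) A4).
  set (v := Cmod (f1 z1)) in *. set (d := Cmod (f1 z1 - f z1)) in *.
  set (x := Cmod (f z1)) in *. set (y := Cmod (f z1 - 1)) in *.
  (* 540^2 = 291600 just exceeds 290000. *)
  set (tau := 540 * R0 / r).
  assert (Ht : 0 < tau) by (apply Rdiv_lt_0_compat; lra).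
  assert (Htau : 290000 * R0 ^ 2 / r ^ 2 <= tau ^ 2).
  { unfold tau. replace ((540 * R0 / r) ^ 2) with (291600 * R0 ^ 2 / r ^ 2) by (field; lra).
    apply Rmult_le_compat_r; [|nra]. left. apply Rinv_0_lt_compat. nra. }
  assert (Key : forall s, 0 < s -> (v / (s * cosh2 (ln s))) ^ 2 <= tau ^ 2 ->
    ln v - ln s - phi (ln s) <= ln tau).
  { intros s Hs Hv. assert (Hc := cosh2_ge2 (ln s)).
    assert (Hsc : 0 < s * cosh2 (ln s)) by (apply Rmult_lt_0_compat; lra).
    assert (Hq : 0 < v / (s * cosh2 (ln s))) by (apply Rdiv_lt_0_compat; assumption).
    assert (Hv' : v / (s * cosh2 (ln s)) <= tau) by nra.
    unfold phi. replace (ln v - ln s - ln (cosh2 (ln s))) with (ln (v / (s * cosh2 (ln s)))).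
    - apply exp_le_inv. rewrite !exp_ln; assumption.
    - unfold Rdiv. rewrite ln_mult, ln_Rinv, ln_mult; try assumption; try lra.
      apply Rinv_0_lt_compat, Hsc. }
  assert (S1 := pow2_ge_0 (v / (x * cosh2 (ln x)))).
  assert (S2 := pow2_ge_0 (v / (y * cosh2 (ln y)))).
  assert (K1 := Key x P3 ltac:(lra)). assert (K2 := Key y P4 ltac:(lra)).
  assert (T1 := Cmod_triangle (f z1 - 1) 1).
  replace (f z1 - 1 + 1)%C with (f z1) in T1 by ring. rewrite Cmod_1 in T1. fold x y in T1.
  assert (T2 := Cmod_triangle (f z1) (- (1))). rewrite Cmod_opp, Cmod_1 in T2.
  change (f z1 + - (1))%C with (f z1 - 1)%C in T2. fold x y in T2.
  assert (T3 := Cmod_triangle (- (f z1 - 1)) (f z1)). rewrite Cmod_opp in T3.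
  replace (- (f z1 - 1) + f z1)%C with (RtoC 1) in T3 by ring. rewrite Cmod_1 in T3. fold x y in T3.
  assert (T4 := Cmod_triangle (f1 z1) (- f z1)). rewrite Cmod_opp in T4.
  change (f1 z1 + - f z1)%C with (f1 z1 - f z1)%C in T4. fold v d x in T4.
  assert (PB := potential_bound (ln x) (ln y) (ln v) (ln d) (ln tau)).
  rewrite !exp_ln in PB by assumption.
  specialize (PB ltac:(apply Rabs_le; lra) ltac:(lra)).
  assert (HD : ln d <= 1 + Rmax (ln v) (ln x)).
  { apply exp_le_inv. rewrite exp_ln, exp_plus by exact P2. assert (He := exp1_ge2).
    assert (V1 : v <= exp (Rmax (ln v) (ln x))).
    { rewrite <- (exp_ln v) at 1 by exact P1. apply exp_le, Rmax_l. }
    assert (V2 : x <= exp (Rmax (ln v) (ln x))).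
    { rewrite <- (exp_ln x) at 1 by exact P3. apply exp_le, Rmax_r. }
    nra. }
  specialize (PB HD K1 K2).
  assert (Lt : ln tau = ln 540 + ln R0 - ln r).
  { unfold tau, Rdiv. rewrite ln_mult, ln_Rinv, ln_mult; try lra. apply Rinv_0_lt_compat, Hr1. }
  rewrite Hr0 in Hcmp. rewrite ln_pow in Hcmp by lra.
  assert (Lr : ln r <= 2 * ln R0).
  { replace (2 * ln R0) with (ln (R0 ^ 2)) by (rewrite ln_pow by lra; simpl; ring).
    apply exp_le_inv. rewrite !exp_ln by (assumption || nra). exact Hrle. }
  assert (LR : 0 <= ln R0) by (rewrite <- ln_1; apply exp_le_inv; rewrite !exp_ln; lra).
  assert (L5 : 0 <= ln 540) by (rewrite <- ln_1; apply exp_le_inv; rewrite !exp_ln; lra).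
  simpl INR in Hcmp. unfold Rmax in PB. destruct (Rle_dec (17 * ln tau) (29 * ln tau)); lra.
Qed.

(** * Conclusion: the case a = 1 and the reduction to it *)

Lemma normalized_case (f f1 f2 f3 : C -> C) :
  (forall w, cder f w (f1 w)) -> (forall w, cder f1 w (f2 w)) -> (forall w, cder f2 w (f3 w)) ->
  ~ (forall w, f1 w = RtoC 0) ->
  (forall z, f z = RtoC 0 -> f1 z = RtoC 0 /\ f2 z = RtoC 0) ->
  (forall z, f z = RtoC 1 -> f1 z = RtoC 1 \/ (f1 z = RtoC 0 /\ f2 z = RtoC 0)) ->
  forall z, f1 z = f z.
Proof.
  intros H1 H2 H3 N1 Z0 Z1. apply NNPP. intros Hne.
  assert (Nc : forall c, ~ (forall w, (f w - c)%C = RtoC 0)).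
  { intros c Hc. apply N1. intros w. apply cder_unique with f w; [apply H1|].
    apply cder_ext with (fun _ => c); [|apply cder_const].
    intros u. replace (f u) with (f u - c + c)%C by ring. rewrite Hc. ring. }
  assert (Nf : ~ (forall w, f w = RtoC 0)).
  { intros Hc. apply (Nc (RtoC 0)). intros w. rewrite Hc. ring. }
  assert (Nk : ~ (forall w, (f1 w - f w)%C = RtoC 0)).
  { intros Hc. apply Hne. intros w. replace (f1 w) with (f1 w - f w + f w)%C by ring.
    rewrite Hc. ring. }
  destruct (generic_point f f1 f2 H1 H2 Nf (Nc (RtoC 1)) N1 Nk) as [z0 G0].
  assert (Hlam : forall w, @continuous C_UniformSpace R_UniformSpace (lam f f1) w).
  { intros w. apply (lam_continuous f f1 f2); auto. }
  set (K := 100 + 29 * ln 540 - potential f f1 z0).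
  (* The decay estimate amounts to 17 log R <= K. The radius with log R = |K| + 1 violates it. *)
  assert (D := potential_decay f f1 f2 f3 z0 (exp (Rabs K + 1)) H1 H2 H3 Hlam G0).
  assert (HR : 1 <= exp (Rabs K + 1)).
  { rewrite <- exp_0 at 1. apply exp_le. assert (H := Rabs_pos K). lra. }
  specialize (D HR). rewrite ln_exp in D. assert (H := Rle_abs K). assert (H' := Rabs_pos K).
  unfold K in *. lra.
Qed.

Lemma zero_derivative_constant (f : C -> C) : (forall w, cder f w (RtoC 0)) -> forall z, f z = f (RtoC 0).
Proof.
  intros H z.
  assert (E := CInt_rder (fun t => f (0 + RtoC t * z)%C) (fun _ => 0 * z)%C 0 1).
  rewrite CInt_const in E.
  assert (E' : (RtoC (1 - 0) * (0 * z) = f (0 + 1 * z) - f (0 + 0 * z))%C).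
  { apply E; [|intros; apply ccont_const]. intros t.
    apply (rder_comp f (fun t => 0 + RtoC t * z)%C); [apply rder_line|apply H]. }
  replace (0 + 1 * z)%C with z in E' by ring. replace (0 + 0 * z)%C with (RtoC 0) in E' by ring.
  replace (f z) with (f z - f (RtoC 0) + f (RtoC 0))%C by ring. rewrite <- E'. ring.
Qed.

Theorem theorem1 (f : C -> C) (a : C)
  (f_entire : entire f)
  (f_nonconstant : ~ (exists c : C, forall z : C, f z = c))
  (a_neq0 : a <> RtoC 0)
  (share_a : share_simple_points f (C_derive f) a)
  (share_0 : share_simple_points f (C_derive f) (RtoC 0)) :
  forall z : C, f z = C_derive f z.
Proof.
  assert (Hf : holo f).
  { intros z. destruct (f_entire z) as [l Hl]. exists l. apply is_derive_cder, Hl. }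
  destruct (holo_derivative f Hf) as [f1 [H1 Hf1]].
  destruct (holo_derivative f1 Hf1) as [f2 [H2 Hf2]].
  destruct (holo_derivative f2 Hf2) as [f3 [H3 _]].
  assert (E1 : forall z, C_derive f z = f1 z)
    by (intros z; apply is_C_derive_unique, cder_is_derive, H1).
  assert (E2 : forall z, C_derive (C_derive f) z = f2 z).
  { intros z. apply is_C_derive_unique, cder_is_derive.
    apply cder_ext with f1; [intros; symmetry; apply E1|apply H2]. }
  (* A simple zero of f' would be a simple zero of f, where f' is nonzero. So f' has no simple
     zeros. *)
  assert (Zz : forall z, f1 z = RtoC 0 -> f2 z = RtoC 0).
  { intros z E. apply NNPP. intros Hn. destruct (share_0 z) as [_ S]. unfold is_simple_point in S.
    rewrite E1, E2 in S. destruct (S (conj E Hn)) as [_ K]. exact (K E). }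
  (* A simple zero of f would be a zero of f', contrary to simplicity. Together with the preceding
     fact, f'' vanishes at the zeros of f as well. *)
  assert (Z0 : forall z, f z = RtoC 0 -> f1 z = RtoC 0).
  { intros z E. apply NNPP. intros Hn. destruct (share_0 z) as [S _]. unfold is_simple_point in S.
    rewrite E1, E2 in S. destruct (S (conj E Hn)) as [K _]. exact (Hn K). }
  assert (Za : forall z, f z = a -> f1 z = a \/ f1 z = RtoC 0).
  { intros z E. destruct (Ceq_dec (f1 z) (RtoC 0)) as [Hz|Hz]; [right; exact Hz|left].
    destruct (share_a z) as [S _]. unfold is_simple_point in S.
    rewrite E1, E2 in S. apply (S (conj E Hz)). }
  assert (Hs : forall g g1 w, cder g w (g1 w) -> cder (fun w => / a * g w)%C w (/ a * g1 w)%C).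
  { intros g g1 w Hg. replace (/ a * g1 w)%C with (0 * g w + / a * g1 w)%C by ring.
    exact (cder_mult (fun _ => / a)%C g w _ _ (cder_const _ _) Hg). }
  assert (Hc : forall w, (/ a * w = 0)%C -> w = RtoC 0).
  { intros w Hw. replace w with (a * (/ a * w))%C by (field; exact a_neq0). rewrite Hw. ring. }
  (* Division by a moves the a-points to 1-points and preserves the zeros of f, f' and f''. *)
  assert (N := normalized_case (fun w => / a * f w)%C (fun w => / a * f1 w)%C
    (fun w => / a * f2 w)%C (fun w => / a * f3 w)%C
    ltac:(intros; apply Hs, H1) ltac:(intros; apply Hs, H2) ltac:(intros; apply Hs, H3)).
  cbv beta in N. intros z. rewrite E1.
  replace (f z) with (a * (/ a * f z))%C by (field; exact a_neq0). rewrite <- N.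
  - field. exact a_neq0.
  - intros Hz. apply f_nonconstant. exists (f (RtoC 0)). apply zero_derivative_constant.
    intros w. rewrite <- (Hc _ (Hz w)). apply H1.
  - intros w Hw. apply Hc in Hw. rewrite (Z0 w Hw), (Zz w (Z0 w Hw)). split; ring.
  - intros w Hw.
    assert (Ha : f w = a).
    { replace (f w) with (a * (/ a * f w))%C by (field; exact a_neq0). rewrite Hw. ring. }
    destruct (Za w Ha) as [Hw1|Hw1]; rewrite Hw1.
    + left. field. exact a_neq0.
    + right. rewrite (Zz w Hw1). split; ring.
Qed.
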